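(* Let $\mathbb{D}\subset\mathbb{R}^2$ be the closed unit disk. For any compact convex set $X\subset\mathbb{R}^2$ with perimeter $\ell(\partial X)=2\pi$ such that $X$ is not a disk, there exists $\epsilon>0$ such that $P_X(l)<P_{\mathbb{D}}(l)$ for all $l\in(0,\epsilon)$.
   Context: For $x\in\mathbb{R}^2$ and $l>0$, a random needle of length $l$ at $x$ is the directed line segment of length $l$ starting at $x$ whose angle with the horizontal axis is chosen uniformly from $[0,2\pi)$; a random needle of length $0$ at $x$ is the point $x$. For a bounded convex set $X\subset\mathbb{R}^2$, the pointwise probability $p_X(x,l)$ (for $x\in X$, $l\ge 0$) is the probability that a random needle of length $l$ at $x$ lies entirely within $X$. The Buffon probability $P_X(l)$ is the probability that a random needle of length $l$ at a point $x$ chosen uniformly from $X$ lies entirely within $X$, i.e. $P_X(l)=\frac{1}{\mathcal{A}(X)}\int_X p_X(x,l)\,dx$, where $\mathcal{A}$ denotes area. $\ell$ denotes length, so $\ell(\partial X)$ is the perimeter of $X$. *)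

(* Defs.v *)
(* The plane R^2 is modelled as R * R (product
   topology = Euclidean topology), area is the product Lebesgue measure. *)
From HB Require Import structures.
From mathcomp Require Import all_boot all_order all_algebra.
From mathcomp Require Import all_classical all_reals all_analysis.
Set Implicit Arguments. Unset Strict Implicit. Unset Printing Implicit Defensive.
Import Order.TTheory GRing.Theory Num.Theory.
Import numFieldNormedType.Exports.
Local Open Scope classical_set_scope.
Local Open Scope ring_scope.

Section Buffon.
Variable R : realType.
Definition pt := (R * R)%type.

Definition enorm (x : pt) : R := Num.sqrt (x.1 ^+ 2 + x.2 ^+ 2).
Definition edist (x y : pt) : R := enorm (x.1 - y.1, x.2 - y.2).

Definition area (X : set pt) : \bar R :=
  ((@lebesgue_measure R) \x (@lebesgue_measure R))%E X.

Definition disk (c : pt) (r : R) : set pt := [set x | edist x c <= r].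
Definition unit_disk : set pt := disk (0, 0) 1.
Definition is_disk (X : set pt) : Prop := exists c r, 0 < r /\ X = disk c r.

Definition boundary (X : set pt) : set pt := closure X `\` interior X.

Definition curve_length (g : R -> pt) (a b : R) : \bar R :=
  ereal_sup [set v : \bar R | exists (n : nat) (s : nat -> R),
      [/\ s 0%N = a, s n = b, (forall i, (i < n)%N -> s i <= s i.+1) &
           v = (\sum_(i < n) edist (g (s i.+1)) (g (s i)))%:E]].

Definition has_perimeter (X : set pt) (L : R) : Prop :=
  exists g : R -> pt,
    {within `[0, 1], continuous g} /\ g 0 = g 1 /\
    {in `[0, 1[ &, injective g} /\
    g @` `[0, 1] = boundary X /\
    curve_length g 0 1 = L%:E.

Definition needle_in (X : set pt) (x : pt) (l th : R) : Prop :=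
  forall t, 0 <= t <= 1 -> X (x.1 + t * l * cos th, x.2 + t * l * sin th).

Definition pointwise_prob (X : set pt) (x : pt) (l : R) : R :=
  fine ((@lebesgue_measure R) [set th | `[0, 2 * pi[%classic th /\ needle_in X x l th])
  / (2 * pi).

Definition buffon_prob (X : set pt) (l : R) : R :=
  fine (\int[(@lebesgue_measure R) \x (@lebesgue_measure R)]_(x in X)
          (pointwise_prob X x l)%:E)%E / fine (area X).
End Buffon.

(* Main.v *)
(* The measure of pairs (x, theta) with x and x + l u_theta in X is the integral
   over theta of the area of the intersection of X and X - l u_theta.  For convex X the complement
   X \ (X - l u) has area at most l w, where w is the width of X seen along u, and
   at least l (w - O(l)), with a constant uniform in u.  Hence, to first order in l,
   1 - P_X(l) is l W / (pi A), where A is the area and W the integral of the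
   support function, and it remains to prove W > 2 A.

   Let r be the inradius.  Peeling a circumscribed equiangular polygon layer by
   layer (the layer of depth d has area at most d times the perimeter, and moving
   the sides by d reduces the perimeter by at least 2 pi d) gives Bonnesen's
   inequality A <= r W - pi r^2.  Inscribed polygons and Cauchy's perimeter formula
   give W <= 2 pi.  If W <= 2 A, these bounds together force r = 1 and A <= pi, so
   X contains a unit disk of at least its own area and is that disk.

   Instead of W itself one can work with the Riemann sums of the support function
   at the 4 K directions k * 2 pi / (4 K), with errors O(1 / K). *)
Require Import Defs.
From HB Require Import structures.
From mathcomp Require Import all_boot all_order all_algebra.
From mathcomp Require Import all_classical all_reals all_analysis.
From mathcomp Require Import measurable_realfun ring lra.
Set Implicit Arguments. Unset Strict Implicit. Unset Printing Implicit Defensive.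
Import Order.TTheory GRing.Theory Num.Theory.
Import numFieldNormedType.Exports.
Local Open Scope classical_set_scope.
Local Open Scope ring_scope.

(** * Areas in the plane *)

(** For the disk the first-order loss is [2 * l / pi], because its width integral is twice its area;
    this is where the target [W > 2 A] comes from. A strict inequality between limits cannot be used
    directly with a fixed [eps], and this fixes the order of choices. If the Riemann sum stays
    within an [O(step)] error of the bound for every [K], passing to the limit lands in the equality
    case. Otherwise one [K] with a positive margin is frozen, and [eps] is computed from that
    margin.

    The same sum of support values at [4 * K] directions serves three estimates. It controls the
    needles angular sector by angular sector, it gives the perimeter of the circumscribed polygon
    that is peeled, and it is bounded above by the perimeter of [X]. The errors therefore depend
    only on the step, on a bound [M] for the coordinates and, for needles, on a ball inside [X].

    The inradius is used because each of the two bounds on [W] turns Bonnesen's inequality into a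
    relation between [A] and [r] only, and these two relations determine [r]. For the disk itself a
    lower bound on the area suffices. *)

Section Product.
Context d1 d2 (T1 : measurableType d1) (T2 : measurableType d2) (R : realType).
Variable m1 : {sigma_finite_measure set T1 -> \bar R}.
Variable m2 : {sigma_finite_measure set T2 -> \bar R}.

Lemma product_measure12 (F : set (T1 * T2)) : measurable F ->
  (m1 \x m2)%E F = (m1 \x^ m2)%E F.
Proof.
apply: product_measure_unique => A B mA mB.
exact: product_measure2E.
Qed.

Lemma product_measure1_le (F : set (T1 * T2)) (I : set T1) (c : R) :
  measurable F -> measurable I ->
  (forall x, I x -> (m2 (xsection F x) <= c%:E)%E) ->
  (forall x, ~ I x -> xsection F x = set0) ->
  ((m1 \x m2)%E F <= c%:E * m1 I)%E.
Proof.
move=> mF mI h1 h2; rewrite /product_measure1.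
have -> : (\int[m1]_x (m2 \o xsection F) x =
           \int[m1]_(x in I) (m2 \o xsection F) x)%E.
  rewrite [RHS]integral_mkcond; apply: eq_integral => x _ /=.
  rewrite /patch; case: ifPn => //; rewrite notin_setE => /h2 ->.
  by rewrite measure0.
rewrite -integral_cst//; apply: ge0_le_integral => //=.
by apply: measurable_funTS; exact: measurable_fun_xsection.
Qed.

Lemma product_measure1_ge (F : set (T1 * T2)) (I : set T1) (c : R) :
  measurable F -> measurable I -> 0 <= c ->
  (forall x, I x -> (c%:E <= m2 (xsection F x))%E) ->
  (c%:E * m1 I <= (m1 \x m2)%E F)%E.
Proof.
move=> mF mI c0 h; rewrite /product_measure1 -integral_cst//.
have mm := measurable_fun_xsection m2 mF.
apply: (@le_trans _ _ (\int[m1]_(x in I) (m2 \o xsection F) x)%E).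
  apply: ge0_le_integral => //=.
  by apply: measurable_funTS.
apply: ge0_subset_integral => //.
Qed.

Lemma product_measure2_le (F : set (T1 * T2)) (I : set T2) (c : R) :
  measurable F -> measurable I ->
  (forall y, I y -> (m1 (ysection F y) <= c%:E)%E) ->
  (forall y, ~ I y -> ysection F y = set0) ->
  ((m1 \x m2)%E F <= c%:E * m2 I)%E.
Proof.
move=> mF mI h1 h2; rewrite product_measure12// /product_measure2.
have -> : (\int[m2]_y (m1 \o ysection F) y =
           \int[m2]_(y in I) (m1 \o ysection F) y)%E.
  rewrite [RHS]integral_mkcond; apply: eq_integral => x _ /=.
  rewrite /patch; case: ifPn => //; rewrite notin_setE => /h2 ->.
  by rewrite measure0.
rewrite -integral_cst//; apply: ge0_le_integral => //=.
by apply: measurable_funTS; exact: measurable_fun_ysection.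
Qed.

Lemma product_measure2_ge (F : set (T1 * T2)) (I : set T2) (c : R) :
  measurable F -> measurable I -> 0 <= c ->
  (forall y, I y -> (c%:E <= m1 (ysection F y))%E) ->
  (c%:E * m2 I <= (m1 \x m2)%E F)%E.
Proof.
move=> mF mI c0 h; rewrite product_measure12// /product_measure2 -integral_cst//.
have mm := measurable_fun_ysection m1 mF.
apply: (@le_trans _ _ (\int[m2]_(y in I) (m1 \o ysection F) y)%E).
  apply: ge0_le_integral => //=.
  by apply: measurable_funTS.
apply: ge0_subset_integral => //.
Qed.

End Product.

Section Plane.
Variable R : realType.
Local Notation mu := (@lebesgue_measure R).

Lemma lebesgue_measure_shift (c : R) (A : set (measurableTypeR R)) :
  measurable A -> mu ((fun y => y + c) @^-1` A) = mu A.
Proof.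
move=> mA.
have mf : measurable_fun [set: measurableTypeR R]
  (fun y : measurableTypeR R => (y + c : measurableTypeR R)).
  exact: measurable_funD.
pose m' := measure_function_pushforward__canonical__measure_function_Measure mu mf.
symmetry; apply: (lebesgue_measure_unique (mu := m')) => // X [[a b] _ <-].
have -> : m' `]a, b]%classic = mu `]a - c, b - c]%classic.
  rewrite /m' /= /pushforward; congr (mu _).
  by apply/seteqP; split => x /=; rewrite !in_itv/= => /andP[h1 h2];
    apply/andP; split; lra.
rewrite !lebesgue_measure_itv/= !lte_fin ltrD2r; case: ifP => // _.
by rewrite -!EFinB; congr EFin; ring.
Qed.


Local Notation RR := (measurableTypeR R * measurableTypeR R)%type.
Local Notation vol := ((@lebesgue_measure R) \x (@lebesgue_measure R))%E.

Lemma measurable_linear2 (a b c : R) :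
  measurable_fun [set: RR] (fun p : RR => a * p.1 + b * p.2 + c : measurableTypeR R).
Proof.
apply: measurable_funD => //.
apply: measurable_funD; apply: measurable_funM => //.
Qed.

Lemma measurable_affine (a b c d e f : R) :
  measurable_fun [set: RR]
   (fun p : RR => (a * p.1 + b * p.2 + c, d * p.1 + e * p.2 + f) : RR).
Proof. by apply: measurable_fun_pair; exact: measurable_linear2. Qed.

Lemma measurable_preimage_affine (a b c d e f : R) (A : set RR) :
  measurable A ->
  measurable ((fun p : RR => (a * p.1 + b * p.2 + c, d * p.1 + e * p.2 + f) : RR)
    @^-1` A).
Proof. by move=> mA; rewrite -[X in measurable X]setTI; exact: measurable_affine. Qed.

Lemma area_shear2 (c e : R) (A : set RR) : measurable A ->
  vol ((fun p : RR => (p.1, c * p.1 + p.2 + e) : RR) @^-1` A) = vol A.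
Proof.
move=> mA; rewrite /product_measure1; apply: eq_integral => x _ /=.
rewrite -[RHS](lebesgue_measure_shift (c * x + e)); last exact: measurable_xsection.
congr (mu _); apply/seteqP; split => y; rewrite /xsection/= !inE/=.
  by rewrite addrAC addrC.
by rewrite addrC addrAC.
Qed.

Lemma area_shear1 (c e : R) (A : set RR) : measurable A ->
  vol ((fun p : RR => (p.1 + c * p.2 + e, p.2) : RR) @^-1` A) = vol A.
Proof.
move=> mA.
have mB : measurable ((fun p : RR => (p.1 + c * p.2 + e, p.2) : RR) @^-1` A).
  have := measurable_preimage_affine 1 c e 0 1 0 mA.
  congr measurable; apply/seteqP; split => p /=; by rewrite !(mul1r, mul0r, add0r, addr0).
have E (B : set RR) : measurable B -> vol B = (mu \x^ mu)%E B.
  by move=> ?; exact: product_measure12.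
rewrite (E _ mB) (E _ mA) /product_measure2; apply: eq_integral => y _ /=.
rewrite -[RHS](lebesgue_measure_shift (c * y + e)); last exact: measurable_ysection.
congr (mu _); apply/seteqP; split => x; rewrite /ysection/= !inE/=.
  by rewrite addrA.
by rewrite addrA.
Qed.

Definition plane_rot (c s : R) (p : pt R) : pt R := (c * p.1 - s * p.2, s * p.1 + c * p.2).

Lemma measurable_rot (c s : R) (A : set RR) :
  measurable A -> measurable (plane_rot c s @^-1` A).
Proof.
move=> mA; have := measurable_preimage_affine c (- s) 0 s c 0 mA.
by congr measurable; apply/seteqP; split => p /=; rewrite /plane_rot !addr0 mulNr.
Qed.

Lemma area_shift (v : pt R) (A : set RR) : measurable A ->
  area ((fun p => (p.1 + v.1, p.2 + v.2)) @^-1` A) = area A.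
Proof.
move=> mA; pose f : RR -> RR := fun p => (p.1 + 0 * p.2 + v.1, p.2).
pose g : RR -> RR := fun p => (p.1, 0 * p.1 + p.2 + v.2).
have mB : measurable (g @^-1` A).
  have := measurable_preimage_affine 1 0 0 0 1 v.2 mA.
  by congr measurable; apply/seteqP; split => p; rewrite /g/= !(mul1r, mul0r, add0r, addr0).
have -> : (fun p => (p.1 + v.1, p.2 + v.2)) @^-1` A = f @^-1` (g @^-1` A).
  by apply/seteqP; split => p; rewrite /f/g/= !(mul0r, add0r, addr0).
apply: (etrans (area_shear1 0 v.1 mB)); exact: (area_shear2 0 v.2 mA).
Qed.

(* A rotation is a product of three shears, with t = tan (theta / 2). *)
Lemma area_rot (c s : R) (A : set RR) : measurable A ->
  c ^+ 2 + s ^+ 2 = 1 -> area (plane_rot c s @^-1` A) = area A.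
Proof.
move=> mA.
have gen (c' s' : R) (B : set RR) : measurable B -> 1 + c' != 0 ->
    c' ^+ 2 + s' ^+ 2 = 1 -> area (plane_rot c' s' @^-1` B) = area B.
  move=> mB c1 cs; pose t := s' / (1 + c'); rewrite /area.
  have mS u (C : set RR) : measurable C ->
      measurable ((fun p : RR => (p.1 + u * p.2 + 0, p.2) : RR) @^-1` C).
    move=> mC; have := measurable_preimage_affine 1 u 0 0 1 0 mC.
    congr measurable; apply/seteqP; split => p /=; by rewrite !(mul1r, mul0r, add0r, addr0).
  have mS2 u (C : set RR) : measurable C ->
      measurable ((fun p : RR => (p.1, u * p.1 + p.2 + 0) : RR) @^-1` C).
    move=> mC; have := measurable_preimage_affine 1 0 0 u 1 0 mC.
    congr measurable; apply/seteqP; split => p /=; by rewrite !(mul1r, mul0r, add0r, addr0).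
  have s2 : s' ^+ 2 = (1 - c') * (1 + c') by lra.
  have st : s' * t = 1 - c' by rewrite /t mulrA -expr2 s2 mulfK.
  have tc : t * c' = s' - t.
    by rewrite /t; apply: (mulIf c1); rewrite mulrBl divfK// mulrAC divfK//; ring.
  pose f : RR -> RR := fun p => (p.1 + - t * p.2 + 0, p.2).
  pose g : RR -> RR := fun p => (p.1, s' * p.1 + p.2 + 0).
  have -> : plane_rot c' s' @^-1` B = f @^-1` (g @^-1` (f @^-1` B)).
    apply/funext => p; rewrite /preimage/=; congr B.
    rewrite /plane_rot/f/g/= !addr0; congr pair.
      transitivity (p.1 * (1 - s' * t) + p.2 * (- t + s' * t * t - t)); last by ring.
      have -> : s' * t * t = t - t * c' by rewrite st; ring.
      by rewrite st tc; ring.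
    transitivity (s' * p.1 + (1 - s' * t) * p.2); last by ring.
    by rewrite st; ring.
  have mfB : measurable (f @^-1` B) := mS _ _ mB.
  have mgB : measurable (g @^-1` (f @^-1` B)) := mS2 _ _ mfB.
  apply: (etrans (area_shear1 (- t) 0 mgB)).
  apply: (etrans (area_shear2 s' 0 mfB)).
  exact: (area_shear1 (- t) 0 mB).
have [c1|c1] := eqVneq (1 + c) 0; last exact: gen.
move=> cs; have cE : c = -1 by lra.
have s0 : s = 0.
  by apply/eqP; rewrite -sqrf_eq0; apply/eqP; move: cs; rewrite cE; lra.
(* At the half turn [t] has a pole, so this case is done as two quarter turns. *)
have E : plane_rot c s @^-1` A = plane_rot 0 1 @^-1` (plane_rot 0 1 @^-1` A).
  rewrite cE s0; apply/funext => p; rewrite /preimage/=; congr A.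
  by rewrite /plane_rot/=; congr pair; ring.
have c01 : 1 + 0 != 0 :> R by rewrite addr0 oner_eq0.
have cs01 : 0 ^+ 2 + 1 ^+ 2 = 1 :> R by rewrite expr0n expr1n add0r.
rewrite E; apply: (etrans (gen 0 1 _ _ c01 cs01)); first exact: measurable_rot.
exact: gen.
Qed.

Lemma open_measurable2 (U : set (R * R)) : open U -> measurable (U : set RR).
Proof.
move=> oU.
pose box (a b c d : rat) : set RR :=
  (`]ratr a, ratr b[%classic `*` `]ratr c, ratr d[%classic).
(* Boxes not contained in [U] are replaced by the empty set, so that the union runs over all
   rational quadruples and is countable. *)
have -> : U = \bigcup_a \bigcup_b \bigcup_c \bigcup_d
    (if pselect (box a b c d `<=` U) then box a b c d else set0).
  apply/seteqP; split => p.
    move=> Up; have : nbhs p U by exact: open_nbhs_nbhs.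
    move=> -[[A B]] /= [/nbhs_ballP[e1 /= e10 h1] /nbhs_ballP[e2 /= e20 h2]] hAB.
    have [a ha] := rat_in_itvoo (ltac:(lra) : p.1 - e1 < p.1).
    have [b hb] := rat_in_itvoo (ltac:(lra) : p.1 < p.1 + e1).
    have [c hc] := rat_in_itvoo (ltac:(lra) : p.2 - e2 < p.2).
    have [d hd] := rat_in_itvoo (ltac:(lra) : p.2 < p.2 + e2).
    rewrite !in_itv/= in ha hb hc hd.
    exists a => //; exists b => //; exists c => //; exists d => //.
    case: pselect => /= [_|[]].
      by rewrite /box; split => /=; rewrite in_itv/=; lra.
    move=> [x y] [/=]; rewrite !in_itv/= => hx hy; apply: hAB; split => /=.
      by apply: h1; rewrite /ball/= /ball_/= ltr_norml; lra.
    by apply: h2; rewrite /ball/= /ball_/= ltr_norml; lra.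
  by move=> [a _ [b _ [c _ [d _]]]]; case: pselect => //= h; exact: h.
do 4! (apply: bigcupT_measurable_rat => ?).
by case: pselect => //= _; apply: measurableX; exact: measurable_itv.
Qed.

Lemma closed_measurable2 (A : set (R * R)) : closed A -> measurable (A : set RR).
Proof.
move=> cA; rewrite -[A]setCK; apply: measurableC; apply: open_measurable2.
exact: closed_openC.
Qed.

Lemma compact_closed2 (A : set (pt R)) : compact A -> closed A.
Proof. by apply: compact_closed; exact: (@norm_hausdorff R (R * R)%type). Qed.

Lemma compact_measurable2 (A : set (pt R)) : compact A -> measurable (A : set RR).
Proof. by move=> /compact_closed2/closed_measurable2. Qed.

Lemma area_rect (a b c d : R) : a <= b -> c <= d ->
  area (`[a, b] `*` `[c, d]) = ((b - a) * (d - c))%:E.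
Proof.
move=> ab cd.
have len (x y : R) : x <= y -> mu `[x, y]%classic = (y - x)%:E.
  move=> xy; rewrite lebesgue_measure_itv/= lte_fin; case: ltP => h.
    by rewrite EFinB.
  by congr EFin; lra.
apply: (etrans (product_measure1E mu mu _ _)) => //.
by rewrite EFinM; congr (_ * _)%E; exact: len.
Qed.

(* A name for the area as a measure on which the sigma-finite structure can be
   declared: the library's instance on product_measure1 is shadowed. *)
Definition plane_area : set RR -> \bar R := vol.

HB.instance Definition _ := Measure.on plane_area.

Lemma plane_area_sigma_finite : sigma_finite setT plane_area.
Proof.
pose F n : set RR := `[(- n%:R : R), n%:R] `*` `[(- n%:R : R), n%:R].
exists F.
  apply/seteqP; split => // p _.
  have [m hm] : exists m : nat, `|p.1| + `|p.2| <= m%:R.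
    by exists (Num.truncn (`|p.1| + `|p.2|)).+1; rewrite ltW// truncnS_gt.
  have := normr_ge0 p.1; have := normr_ge0 p.2 => h1 h2.
  by exists m => //; split; rewrite /= in_itv/= -ler_norml; lra.
move=> n; split; first by apply: measurableX; exact: measurable_itv.
have n0 : - n%:R <= n%:R :> R by rewrite ge0_cp.
by apply: le_lt_trans (ltry ((n%:R - - n%:R) * (n%:R - - n%:R))); rewrite -area_rect.
Qed.

HB.instance Definition _ :=
  Measure_isSigmaFinite.Build _ _ _ plane_area plane_area_sigma_finite.

End Plane.

(** * Trigonometry *)

Section Trig.
Variable R : realType.
Implicit Types (th ph x y : R) (p q : pt R).

Definition hdot th p : R := p.1 * cos th + p.2 * sin th.

Lemma hdot_rot th ph q :
  hdot th (plane_rot (cos ph) (sin ph) q) = hdot (th - ph) q.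
Proof. rewrite /hdot /plane_rot/= cosB sinB; ring. Qed.

Lemma hdot0 q : hdot 0 q = q.1.
Proof. by rewrite /hdot cos0 sin0 mulr1 mulr0 addr0. Qed.

Lemma hdotDpi th q : hdot (th + pi) q = - hdot th q.
Proof. rewrite /hdot sinDpi cosDpi; ring. Qed.

Lemma hdotD2pi th q : hdot (th + 2 * pi) q = hdot th q.
Proof. by rewrite mulr_natl /hdot sinD2pi cosD2pi. Qed.

Lemma cos_lip x y : `|cos x - cos y| <= `|x - y|.
Proof.
wlog xy : x y / x <= y.
  move=> H; have [/H//|/ltW/H] := leP x y.
  by rewrite distrC [X in _ <= X]distrC.
have [c _] := @MVT_segment R cos (fun z => - sin z) _ _ xy
  (fun z _ => is_derive_cos z) (continuous_subspaceT (@continuous_cos R)).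
rewrite distrC => ->; rewrite normrM [X in _ <= X]distrC ler_piMl// normrN.
exact: sin_max.
Qed.

Lemma sin_lip x y : `|sin x - sin y| <= `|x - y|.
Proof.
wlog xy : x y / x <= y.
  move=> H; have [/H//|/ltW/H] := leP x y.
  by rewrite distrC [X in _ <= X]distrC.
have [c _] := @MVT_segment R sin cos _ _ xy
  (fun z _ => is_derive_sin z) (continuous_subspaceT (@continuous_sin R)).
rewrite distrC => ->; rewrite normrM [X in _ <= X]distrC ler_piMl//.
exact: cos_max.
Qed.

Lemma sin_le_id x : 0 <= x -> sin x <= x.
Proof.
move=> x0; have := sin_lip x 0; rewrite sin0 !subr0 (ger0_norm x0).
exact: le_trans (ler_norm _).
Qed.

Lemma tan_ge_id x : 0 <= x < pi / 2 -> x <= tan x.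
Proof.
move=> /andP[x0 x1].
have ltz z : z <= x -> 0 <= z -> 0 < cos z.
  move=> zx z0; apply: cos_gt0_pihalf; have := pi_gt0 R; lra.
have hd z : z \in `]0, x[ -> is_derive z 1 tan ((cos z)^-2).
  rewrite in_itv/= => /andP[z0 zx].
  by apply: is_derive_tan; rewrite gt_eqF// ltz// ltW.
have hc : {within `[0, x], continuous (@tan R)}.
  apply: continuous_in_subspaceT => z; rewrite inE/= in_itv/= => /andP[z0 zx].
  by apply: continuous_tan; rewrite gt_eqF// ltz.
have [c] := MVT_segment x0 hd hc.
rewrite in_itv/= => /andP[c0 cx]; rewrite tan0 !subr0 => ->.
rewrite ler_peMl// -exprVn exprn_ege1// invf_ge1 ?cos_le1// ltz//.
Qed.

(** The product [2 * cos x * sin (al / 2)] is the difference of the sines at [x + al / 2] and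
    [x - al / 2], and consecutive terms share an endpoint. *)
Lemma sum_cos_telescope ph (al : R) n m :
  (\sum_(m <= k < n) cos (ph - k%:R * al)) * (2 * sin (al / 2)) =
  if (m <= n)%N then
  sin (ph + al / 2 - m%:R * al) - sin (ph + al / 2 - n%:R * al) else 0.
Proof.
case: leqP => [|/ltnW nm]; last by rewrite big_geq// mul0r.
elim: n => [|n IH].
  by rewrite leqn0 => /eqP ->; rewrite big_geq// mul0r subrr.
rewrite leq_eqVlt => /predU1P[->|]; first by rewrite big_geq// mul0r subrr.
rewrite ltnS => mn; rewrite big_nat_recr//= mulrDl IH//.
set a := ph - n%:R * al.
have -> : ph + al / 2 - n%:R * al = a + al / 2 by rewrite /a; ring.
have -> : ph + al / 2 - n.+1%:R * al = a - al / 2 by rewrite /a -natr1; field.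
set b := sin _; rewrite !sinD !(cosN, sinN); ring.
Qed.

(* On the half turn ph - k * pi / M the cosine changes sign once, at k = m, so
   the sum telescopes into two increments of the sine. *)
Lemma sum_abs_cos ph M : (0 < M)%N -> - (pi / 2) <= ph <= pi / 2 ->
  (\sum_(0 <= k < M) `|cos (ph - k%:R * (pi / M%:R))|) *
    (2 * sin (pi / M%:R / 2)) <= 2.
Proof.
move=> M0 /andP[ph1 ph2]; have pi0 := pi_gt0 R.
set al := pi / M%:R.
have al0 : 0 < al by rewrite divr_gt0// ltr0n.
have Mal : M%:R * al = pi by rewrite /al mulrCA divff ?mulr1// pnatr_eq0 -lt0n.
have [m [mM h1 h2]] : exists m, [/\ (m <= M)%N,
   (forall k, (k < m)%N -> k%:R * al <= ph + pi / 2) &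
   (forall k, (m <= k < M)%N -> ph + pi / 2 <= k%:R * al)].
  have : exists m, (m <= M)%N && (ph + pi / 2 <= m%:R * al).
    by exists M; rewrite leqnn/= Mal; lra.
  move=> ex; case: (ex_minnP ex) => m /andP[mM hm] mmin.
  exists m; split => // k.
    move=> km; rewrite leNgt; apply/negP => /ltW hk.
    have := mmin k; rewrite hk (leq_trans (ltnW km) mM) => /(_ isT).
    by rewrite leqNgt km.
  move=> /andP[mk _]; by apply: (le_trans hm); rewrite ler_wpM2r ?ler_nat// ltW.
rewrite (big_cat_nat (n := m))//=.
rewrite [X in X + _](_ : _ = \sum_(0 <= k < m) cos (ph - k%:R * al)); last first.
  apply: eq_big_nat => k /andP[_ km]; rewrite ger0_norm//.
  apply: cos_ge0_pihalf; have := h1 _ km.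
  have : 0 <= k%:R * al by rewrite mulr_ge0// ltW.
  lra.
rewrite [X in _ + X](_ : _ = - \sum_(m <= k < M) cos (ph - k%:R * al)); last first.
  rewrite -sumrN; apply: eq_big_nat => k hk; rewrite ler0_norm//.
  have hk2 := h2 _ hk; move/andP: hk => [_ kM].
  have : k%:R * al <= pi.
    by rewrite -Mal ler_wpM2r ?ler_nat; [|exact: ltW|exact: ltnW].
  move=> hk3; rewrite -oppr_ge0 -cosDpi; apply: cos_ge0_pihalf; lra.
rewrite mulrBl !sum_cos_telescope mM leq0n mul0r subr0 Mal.
have E : sin (ph + al / 2 - pi) = - sin (ph + al / 2).
  by rewrite -[in RHS](subrK pi (ph + al / 2)) sinDpi opprK.
(* The outer sines cancel and the total is [-2 * sin (ph + al / 2 - m%:R * al)]. *)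
rewrite E; have := sin_geN1 (ph + al / 2 - m%:R * al); lra.
Qed.

End Trig.

(** * Layers of equiangular polygons *)

Section PeriodicSums.
Variables (V : zmodType) (T : Type) (N : nat).

Definition nperiodic (f : nat -> T) := forall k, f (k + N)%N = f k.

Lemma nperiodic_mod (f : nat -> T) k : nperiodic f -> f (k %% N)%N = f k.
Proof.
move=> hf; rewrite [in RHS](divn_eq k N) addnC.
by elim: (k %/ N)%N => [|q IH]; rewrite ?mul0n ?addn0// mulSn addnCA addnC hf.
Qed.

End PeriodicSums.

Lemma sum_nperiodic_shift (V : zmodType) N (f : nat -> V) m : nperiodic N f ->
  \sum_(0 <= k < N) f (k + m)%N = \sum_(0 <= k < N) f k.
Proof.
move=> hf; elim: m => [|m IH]; first by apply: eq_bigr => k _; rewrite addn0.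
rewrite -IH; case: N hf {IH} => [|N] hf; first by rewrite !big_geq.
rewrite big_nat_recr//= [RHS]big_nat_recl//= addrC; congr (_ + _).
  by rewrite add0n -(hf m) addnC addSnnS.
by apply: eq_bigr => k _; rewrite addSnnS.
Qed.

Section EdgeStrip.
Variable R : realType.
Local Notation mu := (@lebesgue_measure R).
Local Notation RR := (measurableTypeR R * measurableTypeR R)%type.

Lemma measurable_hdot th : measurable_fun [set: RR] (hdot th : RR -> measurableTypeR R).
Proof.
have := measurable_linear2 (cos th) (sin th) 0.
by congr measurable_fun; apply/funext => p; rewrite /hdot addr0 mulrC [X in _ * _ + X]mulrC.
Qed.

Lemma measurable_hdot_le th (c : R) : measurable ([set p | hdot th p <= c] : set RR).
Proof.
have := measurable_hdot th measurableT (measurable_itv `]-oo, c]).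
by rewrite setTI; congr measurable; apply/seteqP; split => p /=; rewrite in_itv.
Qed.

Lemma measurable_hdot_sub th ph (c e : R) :
  measurable ([set p | c - hdot th p <= e - hdot ph p] : set RR).
Proof.
have mf : measurable_fun [set: RR]
    (fun p : RR => (hdot ph p - hdot th p : measurableTypeR R)).
  by apply: measurable_funB; exact: measurable_hdot.
have := mf measurableT _ (measurable_itv `]-oo, e - c]).
rewrite setTI; congr measurable; apply/seteqP; split => p /=; rewrite in_itv/=; lra.
Qed.

(** The share of a layer of thickness [d] that belongs to the middle one of three consecutive sides
    with normals [th - a], [th], [th + a]: the points at least as close to its line as to its two
    neighbours. The corners are thus cut along bisectors. *)
Definition edge_strip (H0 H1 H2 d a th : R) : set (pt R) :=
  [set p | [/\ H1 - d <= hdot th p, hdot th p <= H1,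
      H1 - hdot th p <= H0 - hdot (th - a) p &
      H1 - hdot th p <= H2 - hdot (th + a) p]].

Lemma measurable_edge_strip (H0 H1 H2 d a th : R) :
  measurable (edge_strip H0 H1 H2 d a th : set RR).
Proof.
have -> : edge_strip H0 H1 H2 d a th =
    ([set p | hdot (th + pi) p <= d - H1] `&` [set p | hdot th p <= H1]) `&`
    ([set p | H1 - hdot th p <= H0 - hdot (th - a) p] `&`
     [set p | H1 - hdot th p <= H2 - hdot (th + a) p]).
  apply/seteqP; split => p /=; rewrite hdotDpi.
    by move=> [*]; split; split => //; lra.
  by move=> [[? ?] [? ?]]; split => //; lra.
apply: measurableI; apply: measurableI;
  [exact: measurable_hdot_le..|exact: measurable_hdot_sub|exact: measurable_hdot_sub].
Qed.

(* In the frame whose first axis is the middle normal, the slice at depth x is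
   bounded by the two bisectors, and it is longest at depth 0. *)
Lemma area_edge_strip (H0 H1 H2 d a th : R) :
  0 < sin a -> 0 <= H0 + H2 - 2 * cos a * H1 -> 0 <= d ->
  (area (edge_strip H0 H1 H2 d a th)
  <= (d * ((H0 + H2 - 2 * cos a * H1) / sin a))%:E)%E.
Proof.
(* [l] is the length of the middle side of a polygon with these three support numbers. *)
move=> sa Hl d0; set l := (_ / sin a); set S := edge_strip _ _ _ _ _ _.
have l0 : 0 <= l by rewrite divr_ge0// ltW.
have mS : measurable (S : set RR) by exact: measurable_edge_strip.
have mR : measurable (plane_rot (cos th) (sin th) @^-1` S : set RR).
  exact: measurable_rot.
have -> : area S = area (plane_rot (cos th) (sin th) @^-1` S).
  by rewrite area_rot// cos2Dsin2.
have -> : (d * l)%:E = (l%:E * mu `[(H1 - d)%R, H1]%classic)%E.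
  rewrite lebesgue_measure_itv/= lte_fin; case: ltP => h.
    by rewrite -EFinB -EFinM; congr EFin; ring.
  by rewrite (_ : d = 0) ?mul0r ?mule0//; lra.
apply: product_measure1_le => //.
  move=> x /=; rewrite in_itv/= => /andP[x1 x2].
  pose lo := (H1 - H0 - x * (1 - cos a)) / sin a.
  apply: (@le_trans _ _ (mu `[lo, (lo + l)]%classic)); last first.
    rewrite lebesgue_measure_itv/= lte_fin; case: ifP => _; last by rewrite lee_fin.
    by rewrite -EFinB lee_fin; lra.
  apply: le_measure; rewrite ?inE//; first exact: measurable_xsection.
  move=> y; rewrite /xsection/= inE/= /S /edge_strip/= !hdot_rot subrr hdot0/= => -[_ _].
  rewrite /hdot/= -addrA [in X in _ <= H0 - X](_ : th + (- a - th) = - a); last by ring.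
  rewrite [in X in _ -> _ <= H2 - X -> _](_ : th + a - th = a); last by ring.
  rewrite cosN sinN => h1 h2; rewrite in_itv/=; apply/andP; split.
    by rewrite /lo ler_pdivrMr//; lra.
  rewrite /lo /l -mulrDl ler_pdivlMr//.
  have : 0 <= (H1 - x) * (1 - cos a).
    by rewrite mulr_ge0 ?subr_ge0// cos_le1.
  lra.
move=> x; rewrite /= in_itv/= => hx; apply/seteqP; split => y //=.
rewrite /xsection/= inE/= /S /edge_strip/= !hdot_rot subrr hdot0/= => -[h1 h2 _ _].
by apply: hx; rewrite h1 h2.
Qed.

End EdgeStrip.

Section Polygon.
Variables (R : realType) (N : nat).
Hypothesis N4 : (4 < N)%N.
Local Notation RR := (measurableTypeR R * measurableTypeR R)%type.
Implicit Types (p : pt R) (b : nat -> R).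

Definition step : R := 2 * pi / N%:R.
Local Notation al := step.

Definition ndot (k : nat) p : R := hdot (k%:R * al) p.

(** The index runs over all naturals, with [b] periodic where it matters, so that the neighbours of
    a side are reached by successor without wrapping around. Sides may be redundant: [b] need not
    consist of support numbers. *)
Definition polygon b : set (pt R) := [set p | forall k, ndot k p <= b k].

Lemma step_gt0 : 0 < al.
Proof. by rewrite divr_gt0 ?mulr_gt0 ?pi_gt0// ltr0n; apply: leq_trans N4. Qed.

Lemma N_step : N%:R * al = 2 * pi.
Proof. by rewrite /step mulrC divfK// pnatr_eq0 -lt0n; apply: leq_trans N4. Qed.

(** Five steps fit in a full turn, so the step is acute. This is what makes both its sine and its
    cosine positive. *)
Lemma step_lt_pihalf : al < pi / 2.
Proof.
have h5 : 5 <= N%:R :> R by rewrite ler_nat.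
have al0 := step_gt0; have Na := N_step.
have : 5 * al <= N%:R * al by rewrite ler_wpM2r// ltW.
have := pi_gt0 R; lra.
Qed.

Lemma cos_step_gt0 : 0 < cos al.
Proof.
by apply: cos_gt0_pihalf; have := step_gt0; have := step_lt_pihalf; lra.
Qed.

Lemma sin_step_gt0 : 0 < sin al.
Proof.
apply: sin_gt0_pihalf; have := step_gt0; have := step_lt_pihalf; lra.
Qed.

Lemma sin_half_step_gt0 : 0 < sin (al / 2).
Proof.
apply: sin_gt0_pihalf; have := step_gt0; have := step_lt_pihalf; lra.
Qed.

Lemma cos_half_step_gt0 : 0 < cos (al / 2).
Proof.
apply: cos_gt0_pihalf; have := step_gt0; have := step_lt_pihalf; lra.
Qed.

Lemma sin_step : sin al = 2 * (cos (al / 2) * sin (al / 2)).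
Proof. by rewrite [in LHS](splitr al) -mulr2n sin_mulr2n mulr2n; ring. Qed.

Lemma cos_step : 1 - cos al = 2 * sin (al / 2) ^+ 2.
Proof. by rewrite [in LHS](splitr al) -mulr2n cos_mulr2n cos2sin2; ring. Qed.

Lemma ndot_periodic p : nperiodic N (ndot^~ p).
Proof. by move=> k; rewrite /ndot natrD mulrDl N_step hdotD2pi. Qed.

(** Taken at a point that is extreme in the middle direction, this recurrence says that a side of a
    tight polygon has nonnegative length. *)
Lemma ndot_neighbours k p : ndot k p + ndot k.+2 p = 2 * cos al * ndot k.+1 p.
Proof.
have -> : ndot k p = hdot (k.+1%:R * al - al) p.
  by rewrite /ndot -natr1 mulrDl mul1r addrK.
have -> : ndot k.+2 p = hdot (k.+1%:R * al + al) p.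
  by rewrite /ndot -[in LHS]natr1 mulrDl mul1r.
rewrite /ndot /hdot !cosD !sinD !(cosN, sinN); ring.
Qed.

Lemma measurable_polygon b : measurable (polygon b : set RR).
Proof.
have -> : polygon b = \bigcap_k [set p | ndot k p <= b k].
  by apply/seteqP; split => [p h k _|p h k]; exact: h.
by apply: bigcapT_measurable => k; exact: measurable_hdot_le.
Qed.

(** Each point of the layer is charged to its nearest side, and the strip of a side has area at most
    [d] times its length. The side lengths add up to [2 * tan (al / 2)] times the sum of the support
    numbers. *)
Lemma polygon_layer b d : nperiodic N b -> polygon b !=set0 -> 0 < d ->
  (area (polygon b `\` polygon (fun k => b k - d)%R) <=
   (d * (2 * tan (al / 2)) * \sum_(0 <= k < N) b k)%R%:E)%E.
Proof.
move=> bN [p0 p0Q] d0.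
(* Tight support numbers: with redundant sides the length formula applied to [b] could be
   negative. *)
pose H k := sup (ndot k @` polygon b).
have supP k : has_sup (ndot k @` polygon b).
  by split; [exists (ndot k p0), p0|exists (b k) => _ [p + <-]; exact].
have Hub k p : polygon b p -> ndot k p <= H k.
  by move=> pQ; apply: (ub_le_sup (supP k).2); exists p.
have Hb k : H k <= b k by apply: ge_sup; [exact: (supP k).1|move=> _ [p + <-]; exact].
have HN : nperiodic N H.
  by move=> k; rewrite /H; congr sup; apply: eq_imagel => p _; exact: ndot_periodic.
have ca := cos_step_gt0; have sa := sin_step_gt0.
have edge_ge0 k : 0 <= H k + H k.+2 - 2 * cos al * H k.+1.
  rewrite subr_ge0 mulrC -ler_pdivlMr; last lra.
  apply: ge_sup; first exact: (supP _).1.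
  move=> _ [p pQ <-]; rewrite ler_pdivlMr; last lra.
  by rewrite mulrC -ndot_neighbours lerD// Hub.
pose S k := edge_strip (H k) (H k.+1) (H k.+2) d al (k.+1%:R * al).
have cover : polygon b `\` polygon (fun k => b k - d)%R `<=`
    \big[setU/set0]_(k < N) S k.
  move=> p [pQ /existsNP[k0 /negP]]; rewrite -ltNge => hk0.
  pose D k := H k - ndot k p.
  have DN : nperiodic N (fun k => D k.+1).
    by move=> k; rewrite /D -addSn HN ndot_periodic.
  have N0 : (0 < N)%N by apply: leq_trans N4.
  (* The nearest side is called [j.+1], so that its neighbours are [j] and [j.+2]. Periodicity makes
     the minimum over [N] indices a minimum over all of them. *)
  have [j jmin] : exists j : 'I_N, forall k, D j.+1 <= D k.
    have [j _ hj] := @Order.TotalTheory.arg_minP _ _ 'I_N (Ordinal N0) xpredT (fun i => D i.+1) isT.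
    exists j => k.
    have -> : D k = D ((k + N.-1) %% N)%N.+1.
      by rewrite (nperiodic_mod _ DN) -addnS prednK// /D HN ndot_periodic.
    have kN : ((k + N.-1) %% N < N)%N by rewrite ltn_mod.
    exact: (hj (Ordinal kN) isT).
  apply: (bigsetU_sup (F := S) (ltn_ord j)); split.
  - have := jmin k0; have := Hb k0; rewrite /D /ndot in hk0 *; lra.
  - exact: Hub.
  - have -> : j.+1%:R * al - al = j%:R * al by rewrite -natr1; ring.
    exact: jmin.
  - have -> : j.+1%:R * al + al = j.+2%:R * al by rewrite -[in RHS]natr1; ring.
    exact: jmin.
have mQ b' := measurable_polygon b'.
apply: (@le_trans _ _ (\sum_(k < N) area (S k))%E).
  apply: content_subadditive => //; last exact: measurableD.
  by move=> k _; exact: measurable_edge_strip.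
pose e k := (H k + H k.+2 - 2 * cos al * H k.+1) / sin al.
apply: (@le_trans _ _ (\sum_(k < N) (d * e k)%:E)%E).
  by apply: lee_sum => k _; apply: area_edge_strip => //; exact: ltW.
rewrite sumEFin lee_fin -mulr_sumr -mulrA ler_pM2l//.
(* The three shifted sums of [H] agree by periodicity, and [2 * (1 - cos al) / sin al] is
   [2 * tan (al / 2)]. *)
have -> : \sum_(k < N) e k = 2 * tan (al / 2) * \sum_(0 <= k < N) H k.
  have s1 : \sum_(0 <= k < N) H k.+1 = \sum_(0 <= k < N) H k.
    by rewrite -(sum_nperiodic_shift 1 HN); apply: eq_bigr => k _; rewrite addn1.
  have s2 : \sum_(0 <= k < N) H k.+2 = \sum_(0 <= k < N) H k.
    by rewrite -(sum_nperiodic_shift 2 HN); apply: eq_bigr => k _; rewrite addn2.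
  rewrite -(big_mkord xpredT e) /e -mulr_suml sumrB big_split/= -mulr_sumr s1 s2.
  set s := \sum_(0 <= k < N) _.
  transitivity (2 * (1 - cos al) / sin al * s); first by field; rewrite gt_eqF.
  rewrite cos_step sin_step /tan; congr (_ * _); field.
  by rewrite !gt_eqF// ?cos_half_step_gt0 ?sin_half_step_gt0.
rewrite ler_wpM2l//.
  by rewrite mulr_ge0// divr_ge0// ltW ?cos_half_step_gt0 ?sin_half_step_gt0.
by apply: ler_sum => k _; exact: Hb.
Qed.

(** Nonemptiness at depth [n%:R * d] passes to all shallower polygons, which contain that one. The
    polygon left at the end may be empty. *)
Lemma polygon_layers b d n : nperiodic N b -> 0 < d ->
  polygon (fun k => b k - n%:R * d) !=set0 ->
  (area (polygon b) <= area (polygon (fun k => b k - n.+1%:R * d)%R) +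
   (\sum_(0 <= j < n.+1) d * (2 * tan (al / 2)) *
      \sum_(0 <= k < N) (b k - j%:R * d))%R%:E)%E.
Proof.
move=> bN d0; have mQ b' := measurable_polygon b'.
have step j : polygon (fun k => b k - j%:R * d) !=set0 ->
    (area (polygon (fun k => b k - j%:R * d)%R) <=
     area (polygon (fun k => b k - j.+1%:R * d)%R) +
     (d * (2 * tan (al / 2)) * \sum_(0 <= k < N) (b k - j%:R * d))%R%:E)%E.
  move=> Q0; set Q := polygon _.
  have QE : polygon (fun k => b k - j.+1%:R * d) = polygon (fun k => b k - j%:R * d - d).
    by congr polygon; apply/funext => k; rewrite -natr1; ring.
  have QS : polygon (fun k => b k - j.+1%:R * d) `<=` Q.
    by rewrite QE => p h k; apply: le_trans (h k) _; rewrite gerBl ltW.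
  have -> : area Q = (area (Q `&` polygon (fun k => b k - j.+1%:R * d)%R) +
                      area (Q `\` polygon (fun k => b k - j.+1%:R * d)%R))%E.
    by rewrite addeC; apply: measureDI; exact: mQ.
  rewrite setIidr// leeD2l// QE; apply: polygon_layer => //.
  by move=> k; rewrite bN.
elim: n => [|n IH] Q0.
  have -> : polygon b = polygon (fun k => b k - 0%:R * d).
    by congr polygon; apply/funext => k; rewrite mul0r subr0.
  by rewrite big_nat1; exact: step.
have Qn : polygon (fun k => b k - n%:R * d) !=set0.
  move: Q0 => [p hp]; exists p => k; apply: le_trans (hp k) _.
  by rewrite lerD2l lerN2 ler_wpM2r ?ler_nat// ltW.
apply: (le_trans (IH Qn)); rewrite [in leRHS]big_nat_recr//= EFinD addeCA.
by rewrite addeC leeD2r// step.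
Qed.

(** Discrete Bonnesen inequality. The layers are removed until nothing is left; [r] is the last
    depth, among multiples of [d], at which the polygon is nonempty, hence its inradius up to
    [d]. *)
Lemma polygon_area b (d : R) : ~~ odd N -> nperiodic N b -> 0 < d ->
  polygon b !=set0 ->
  exists r : R, [/\ 0 <= r, polygon (fun k => b k - r) !=set0,
    ~ (polygon (fun k => b k - (r + d)) !=set0) &
    (area (polygon b) <=
     ((r + d) * (2 * tan (al / 2) * \sum_(0 <= k < N) b k) - pi * r ^+ 2)%R%:E)%E].
Proof.
move=> oN bN d0 Q0.
pose P n := `[< ~ (polygon (fun k => b k - n%:R * d) !=set0) >].
have exP : exists n, P n.
  exists (Num.truncn ((`|b 0%N| + `|b N./2|) / d)).+1; apply/asboolP => -[p hp].
  have := hp 0%N; have := hp N./2.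
  (* Evenness of [N] supplies two opposite normals, which squeeze the polygon to nothing at a finite
     depth. *)
  have -> : ndot N./2 p = - ndot 0 p.
    rewrite /ndot -hdotDpi; congr hdot; rewrite mul0r add0r.
    have : N%:R * al = 2 * (N./2%:R * al).
      by rewrite -[in LHS](even_halfK oN) -mul2n natrM mulrA.
    rewrite N_step; lra.
  set m := _.+1 => h1 h2.
  have : (`|b 0%N| + `|b N./2|) / d < m%:R by exact: truncnS_gt.
  rewrite ltr_pdivrMr// => h3.
  have := ler_norm (b 0%N); have := ler_norm (b N./2).
  have := normr_ge0 (b 0%N); have := normr_ge0 (b N./2).
  lra.
case: (ex_minnP exP) => -[|n].
  by move=> /asboolP[]; move: Q0 => [p hp]; exists p => k; rewrite mul0r subr0.
move=> /asboolP Pn nmin; exists (n%:R * d).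
have Qn : polygon (fun k => b k - n%:R * d) !=set0.
  apply: contrapT => /asboolP h; have := nmin n h.
  by rewrite ltnn.
have Pn' : ~ (polygon (fun k => b k - (n%:R * d + d)) !=set0).
  by move: Pn; congr (~ (_ !=set0)); congr polygon; apply/funext => k; rewrite -natr1 mulrDl mul1r.
split => //; first by rewrite mulr_ge0// ltW.
apply: (le_trans (polygon_layers bN d0 Qn)).
have -> : polygon (fun k => b k - n.+1%:R * d) = set0.
  by apply: contrapT => /eqP/set0P.
rewrite /area measure0 add0e lee_fin.
set c := 2 * tan _; set B := \sum_(0 <= k < N) b k.
have -> : \sum_(0 <= j < n.+1) d * c * \sum_(0 <= k < N) (b k - j%:R * d) =
   (n.+1%:R * d) * (c * B) - c * N%:R * d ^+ 2 * ((n.+1%:R * n%:R) / 2).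
  transitivity (\sum_(0 <= j < n.+1) (d * (c * B) - c * N%:R * d ^+ 2 * j%:R)).
    apply: eq_bigr => j _.
    rewrite sumrB -/B big_const_nat iter_addr_0 subn0 -mulr_natr; ring.
  rewrite sumrB big_const_nat iter_addr_0 subn0 -mulr_sumr.
  congr (_ - _ * _); first by rewrite -[LHS]mulr_natl; ring.
  elim: n {nmin Pn Qn Pn'} => [|n IH].
    by rewrite big_nat1 !(mulr0, mul0r).
  by rewrite big_nat_recr//= IH -!natr1; field.
(* The perimeter drops by [c * N%:R * d] per layer. By [tan x >= x] this is at least [2 * pi * d],
   which produces the term [pi * r ^+ 2]. *)
have tl : al / 2 <= tan (al / 2).
  apply: tan_ge_id; have := step_gt0; have := step_lt_pihalf; lra.
have cN : 2 * pi <= c * N%:R.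
  rewrite -N_step mulrC ler_wpM2r//; rewrite /c; lra.
rewrite -natr1 [(_ + 1) * d]mulrDl mul1r lerD2l lerN2.
have n0 : 0 <= n%:R :> R by [].
have -> : (n%:R * d) ^+ 2 = d ^+ 2 * n%:R ^+ 2 by ring.
apply: (@le_trans _ _ (2 * pi * (d ^+ 2 * ((n%:R + 1) * n%:R / 2)))); last first.
  by rewrite -[leRHS]mulrA ler_wpM2r// mulr_ge0 ?sqr_ge0// divr_ge0// mulr_ge0//.
have -> : 2 * pi * (d ^+ 2 * ((n%:R + 1) * n%:R / 2)) = pi * (d ^+ 2 * (n%:R ^+ 2 + n%:R)).
  by field.
rewrite ler_wpM2l ?pi_ge0// ler_wpM2l ?sqr_ge0//; lra.
Qed.

End Polygon.

(** * Support functions *)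

Section Polar.
Variable R : realType.
Implicit Types e p q : pt R.

Lemma enorm_ge0 e : 0 <= enorm e. Proof. exact: sqrtr_ge0. Qed.

Lemma enorm2 e : enorm e ^+ 2 = e.1 ^+ 2 + e.2 ^+ 2.
Proof. by rewrite sqr_sqrtr// addr_ge0 ?sqr_ge0. Qed.

Lemma enorm_eq0 e : enorm e = 0 -> e = (0, 0).
Proof.
move=> e0; have := enorm2 e; rewrite e0 expr0n/= => /esym/eqP.
rewrite paddr_eq0 ?sqr_ge0// !sqrf_eq0 => /andP[/eqP e1 /eqP e2].
by case: e e1 e2 {e0} => /= ? ? -> ->.
Qed.

Lemma enormN e : enorm (- e.1, - e.2) = enorm e.
Proof. by rewrite /enorm/= !sqrrN. Qed.

Lemma polar_half e : 0 <= e.1 -> exists ph, [/\ - (pi / 2) <= ph <= pi / 2,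
  e.1 = enorm e * cos ph & e.2 = enorm e * sin ph].
Proof.
move=> e1; have [/enorm_eq0 ->|en] := eqVneq (enorm e) 0.
  exists 0 => /=; rewrite /enorm/= !expr0n/= addr0 sqrtr0 !mul0r.
  by split => //; have := pi_gt0 R; lra.
have en0 : 0 < enorm e by rewrite lt_neqAle eq_sym en enorm_ge0.
have h := enorm2 e.
set x := e.2 / enorm e.
have x2 : x ^+ 2 <= 1.
  by rewrite expr_div_n ler_pdivrMr ?exprn_gt0// mul1r h lerDr sqr_ge0.
have x1 : -1 <= x <= 1.
  by rewrite -ler_norml -(@ler_sqr _ `|x| 1) ?nnegrE// expr1n real_normK ?num_real.
exists (asin x); rewrite asin_geNpi2// asin_lepi2//; split => //.
  rewrite cos_asin//; have -> : 1 - x ^+ 2 = (e.1 / enorm e) ^+ 2.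
    by rewrite /x !expr_div_n h; field; rewrite -h expf_eq0.
  rewrite sqrtr_sqr ger0_norm ?divr_ge0 ?enorm_ge0// mulrC divfK//.
by rewrite asinK ?in_itv//= /x mulrC divfK.
Qed.

Lemma polar e : exists th, e.1 = enorm e * cos th /\ e.2 = enorm e * sin th.
Proof.
have [e1|e1] := leP 0 e.1.
  by have [ph [_ h1 h2]] := polar_half e1; exists ph.
have [|ph [_ h1 h2]] := @polar_half (- e.1, - e.2); first by rewrite /= oppr_ge0 ltW.
by exists (ph + pi); rewrite cosDpi sinDpi !mulrN; move: h1 h2; rewrite enormN/= => <- <-; rewrite !opprK.
Qed.

(** Cauchy's formula for one segment, as an inequality for finitely many directions. Reversing the
    segment if needed puts its angle in the half turn required by [sum_abs_cos]. *)
Lemma sum_abs_hdot e M : (0 < M)%N ->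
  (\sum_(0 <= k < M) `|hdot (k%:R * (pi / M%:R)) e|) *
    (2 * sin (pi / M%:R / 2)) <= 2 * enorm e.
Proof.
move=> M0; wlog e1 : e / 0 <= e.1.
  move=> H; have [/H//|e1] := leP 0 e.1.
  have := H (- e.1, - e.2); rewrite oppr_ge0 /= => /(_ (ltW e1)).
  rewrite enormN; congr (_ * _ <= _); apply: eq_bigr => k _.
  by rewrite -normrN /hdot/=; congr `|_|; ring.
have [ph [hph h1 h2]] := polar_half e1.
have := sum_abs_cos M0 hph; set a := pi / M%:R => h.
have -> : \sum_(0 <= k < M) `|hdot (k%:R * a) e| =
    enorm e * \sum_(0 <= k < M) `|cos (ph - k%:R * a)|.
  rewrite mulr_sumr; apply: eq_bigr => k _.
  rewrite -{1}(ger0_norm (enorm_ge0 e)) -normrM; congr `|_|.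
  by rewrite /hdot cosB h1 h2; ring.
by rewrite -mulrA mulrC ler_wpM2r ?enorm_ge0.
Qed.

End Polar.

Section Variation.
Variable R : realType.

Lemma variation_ge (f : nat -> R) i j : (i <= j)%N ->
  `|f j - f i| <= \sum_(i <= k < j) `|f k.+1 - f k|.
Proof.
by move=> ij; rewrite -telescope_sumr//; exact: ler_norm_sum.
Qed.

(** A closed walk that visits two values covers the gap between them both going and returning. *)
Lemma closed_variation_ge (f : nat -> R) n i j : f 0%N = f n ->
  (i <= n)%N -> (j <= n)%N ->
  2 * `|f i - f j| <= \sum_(0 <= k < n) `|f k.+1 - f k|.
Proof.
move=> f0n; wlog ij : i j / (i <= j)%N.
  move=> H hi hj; have [/H|/ltnW/H] := leqP i j; first exact.
  by rewrite distrC; exact.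
move=> hi hj.
rewrite (big_cat_nat (n := i))//= (big_cat_nat (n := j) ij)//=.
have h1 := variation_ge f (leq0n i); have h2 := variation_ge f ij.
have h3 := variation_ge f hj.
have : `|f i - f j| <= `|f i - f 0%N| + `|f n - f j|.
  have -> : f i - f j = (f i - f 0%N) + (f n - f j) by rewrite f0n; ring.
  exact: ler_normD.
rewrite [in `|f j - _|]distrC in h2; lra.
Qed.

End Variation.

Section Support.
Variables (R : realType) (X : set (pt R)).
Hypotheses (cX : compact X) (X0 : X !=set0).

Definition supp (th : R) : R := sup (hdot th @` X).

Lemma continuous_hdot th : continuous (hdot th : R * R -> R).
Proof.
move=> p; apply: cvgD; apply: cvgMl; first exact: cvg_fst.
exact: cvg_snd.
Qed.

Lemma supp_attained th : exists2 p, X p & hdot th p = supp th /\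
  forall q, X q -> hdot th q <= supp th.
Proof.
have [p] := compact_EVT_max X0 cX (continuous_subspaceT (@continuous_hdot th)).
rewrite inE => Xp hp.
have hs : has_sup (hdot th @` X).
  by split; [exists (hdot th p), p|exists (hdot th p) => _ [q Xq <-]; apply: hp; rewrite inE].
exists p => //; split; last by move=> q Xq; apply: (ub_le_sup hs.2); exists q.
apply/eqP; rewrite eq_le (ub_le_sup hs.2)/=; last by exists p.
by apply: (ge_sup hs.1) => _ [q Xq <-]; apply: hp; rewrite inE.
Qed.

Lemma hdot_le_supp th q : X q -> hdot th q <= supp th.
Proof. by have [p _ [_]] := supp_attained th; exact. Qed.

Lemma suppD2pi th : supp (th + 2 * pi) = supp th.
Proof. by rewrite /supp; congr sup; apply: eq_imagel => p _; rewrite hdotD2pi. Qed.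

Lemma bounded_coords : exists2 M : R, 0 < M & forall p, X p -> `|p.1| <= M /\ `|p.2| <= M.
Proof.
have [M /= M0 hM] := ex_strict_bound_gt0 (compact_bounded cX).
exists M => // p /hM/ltW /=; rewrite prod_normE ge_max => /andP[]; by split.
Qed.

Lemma hdot_lip (M : R) p th ph : `|p.1| <= M -> `|p.2| <= M ->
  `|hdot th p - hdot ph p| <= 2 * M * `|th - ph|.
Proof.
move=> h1 h2.
have -> : hdot th p - hdot ph p =
  p.1 * (cos th - cos ph) + p.2 * (sin th - sin ph) by rewrite /hdot; ring.
apply: (le_trans (ler_normD _ _)); rewrite !normrM.
have -> : 2 * M * `|th - ph| = M * `|th - ph| + M * `|th - ph| by ring.
by apply: lerD; apply: ler_pM => //; [exact: cos_lip|exact: sin_lip].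
Qed.

Lemma supp_lip M th ph : (forall p, X p -> `|p.1| <= M /\ `|p.2| <= M) ->
  supp th <= supp ph + 2 * M * `|th - ph|.
Proof.
move=> hM; have [p Xp [<- _]] := supp_attained th.
have [h1 h2] := hM _ Xp; have := hdot_lip th ph h1 h2.
have := hdot_le_supp ph Xp; rewrite ler_norml => h /andP[_]; lra.
Qed.

(** Support points are needed on the boundary because the perimeter is the length of a curve tracing
    it. From an interior point, a small move along the normal would increase [hdot th]. *)
Lemma supp_boundary th : exists2 p, boundary X p & hdot th p = supp th.
Proof.
have [p Xp [hp hq]] := supp_attained th; exists p => //; split.
  exact: subset_closure.
rewrite /interior/= => -[[A B]] /= [/nbhs_ballP[e1 /= e10 h1] /nbhs_ballP[e2 /= e20 h2]] hAB.
pose e := Num.min e1 e2 / 2.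
have e0 : 0 < e by rewrite divr_gt0// lt_min e10.
have [ee1 ee2] : e < e1 /\ e < e2.
  have : Num.min e1 e2 <= e1 /\ Num.min e1 e2 <= e2 by rewrite !ge_min !lexx orbT.
  rewrite /e in e0 *; lra.
have Xq : X (p.1 + e * cos th, p.2 + e * sin th).
  apply: hAB; split => /=; [apply: h1|apply: h2]; rewrite /ball/= /ball_/=.
    rewrite opprD addNKr normrN normrM gtr0_norm//.
    by apply: le_lt_trans ee1; rewrite ler_piMr ?cos_max// ltW.
  rewrite opprD addNKr normrN normrM gtr0_norm//.
  by apply: le_lt_trans ee2; rewrite ler_piMr ?sin_max// ltW.
have := hq _ Xq; rewrite -hp.
have -> : hdot th (p.1 + e * cos th, p.2 + e * sin th) =
   hdot th p + e * (cos th ^+ 2 + sin th ^+ 2) by rewrite /hdot/=; ring.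
by rewrite cos2Dsin2 mulr1 gerDl leNgt e0.
Qed.

End Support.

(** * Perimeter and width *)

Section Perimeter.
Variables (R : realType) (X : set (pt R)).
Hypotheses (cX : compact X) (X0 : X !=set0).

(** The order in which the curve meets the chosen support points is unknown, so their parameters are
    sorted together with 0 and 1. Repetitions do no harm, since partitions are only weakly
    increasing. *)
Lemma sorted_partition (ts : seq R) : {in ts, forall t, 0 <= t <= 1} ->
  exists n (s : nat -> R), [/\ s 0%N = 0, s n = 1,
    forall i, (i < n)%N -> s i <= s i.+1 &
    forall t, t \in ts -> exists2 i, (i <= n)%N & s i = t].
Proof.
move=> hts; pose l := sort <=%O (0 :: 1 :: ts).
have l01 t : t \in l -> 0 <= t <= 1.
  by rewrite mem_sort !inE => /predU1P[->|/predU1P[->|/hts//]]; rewrite lexx ler01.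
have sl : (0 < size l)%N by rewrite size_sort.
have so : sorted <=%O l by apply: sort_sorted; exact: le_total.
have le_nth i j : (i <= j)%N -> (j < size l)%N -> nth 0 l i <= nth 0 l j.
  move=> ij js; apply: (sorted_leq_nth le_trans (@lexx _ R)) => //.
  by rewrite inE (leq_ltn_trans ij).
have idx t : t \in l -> exists2 i, (i < size l)%N & nth 0 l i = t.
  by move=> tl; exists (index t l); rewrite ?index_mem ?nth_index.
exists (size l).-1, (nth 0 l); split.
- have [|i il hi] := idx 0; first by rewrite mem_sort inE eqxx.
  apply/le_anti/andP; split; first by rewrite -[leRHS]hi; exact: le_nth.
  by case/andP: (l01 _ (mem_nth 0 sl)).
- have [|i il hi] := idx 1; first by rewrite mem_sort !inE eqxx orbT.
  have sl' : ((size l).-1 < size l)%N by rewrite prednK.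
  apply/le_anti/andP; split; first by case/andP: (l01 _ (mem_nth 0 sl')).
  by rewrite -[leLHS]hi; apply: le_nth => //; rewrite -ltnS prednK.
- by move=> i il; apply: le_nth => //; rewrite -(prednK sl) ltnS.
- move=> t tl; have [|i il hi] := idx t; first by rewrite mem_sort !inE tl !orbT.
  by exists i => //; rewrite -ltnS prednK.
Qed.

(* Cauchy's formula for the perimeter of the polygon inscribed at the support
   points: each direction sees the closed curve cross its width twice. *)
Lemma perimeter_ge L M : (0 < M)%N -> has_perimeter X L ->
  2 * sin (pi / M%:R / 2) *
   \sum_(0 <= k < M) (supp X (k%:R * (pi / M%:R)) + supp X (k%:R * (pi / M%:R) + pi)) <= L.
Proof.
move=> M0 [g [_ [g01 [_ [gX gL]]]]]; set a := pi / M%:R.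
have tP th : exists t, 0 <= t <= 1 /\ hdot th (g t) = supp X th.
  have [p] := supp_boundary cX X0 th; rewrite -gX => -[t].
  by rewrite /= in_itv/= => t01 <- h; exists t.
have [T hT] := choice tP.
pose ts := [seq T (k%:R * a) | k <- iota 0 M] ++ [seq T (k%:R * a + pi) | k <- iota 0 M].
have [|n [s [s0 sn sle sts]]] := @sorted_partition ts.
  by move=> t; rewrite mem_cat => /orP[] /mapP[k _ ->]; apply: (hT _).1.
have lenL : \sum_(i < n) Defs.edist (g (s i.+1)) (g (s i)) <= L.
  rewrite -lee_fin -gL; apply: ereal_sup_ubound; exists n, s; split => //.
pose e i : pt R := ((g (s i.+1)).1 - (g (s i)).1, (g (s i.+1)).2 - (g (s i)).2).
have sa : 0 <= sin (a / 2).
  have pi0 := pi_gt0 R.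
  have a0 : 0 <= a by rewrite divr_ge0// ltW.
  have aM : a <= pi by rewrite ler_pdivrMr ?ltr0n//; apply: ler_peMr; rewrite ?ler1n// ltW.
  apply: sin_ge0_pi; lra.
have width k : (k < M)%N -> supp X (k%:R * a) + supp X (k%:R * a + pi) <=
    (\sum_(0 <= i < n) `|hdot (k%:R * a) (e i)|) / 2.
  move=> kM; pose f i := hdot (k%:R * a) (g (s i)).
  have f0n : f 0%N = f n by rewrite /f s0 sn g01.
  have [i hi si] : exists2 i, (i <= n)%N & s i = T (k%:R * a).
    by apply: sts; rewrite mem_cat map_f// mem_iota.
  have [j hj sj] : exists2 j, (j <= n)%N & s j = T (k%:R * a + pi).
    by apply: sts; rewrite mem_cat (map_f (fun k => T (k%:R * a + pi))) ?orbT// mem_iota.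
  have := closed_variation_ge f0n hi hj.
  have -> : \sum_(0 <= k0 < n) `|f k0.+1 - f k0| = \sum_(0 <= i < n) `|hdot (k%:R * a) (e i)|.
    by apply: eq_bigr => m _; congr (`|_|); rewrite /f /hdot/=; ring.
  have := ler_norm (f i - f j).
  have -> : f i = supp X (k%:R * a) by rewrite /f si; apply: (hT _).2.
  have -> : f j = - supp X (k%:R * a + pi).
    by rewrite -(hT _).2 hdotDpi opprK /f sj.
  lra.
apply: le_trans lenL.
rewrite mulrC -(big_mkord xpredT (fun i => Defs.edist (g (s i.+1)) (g (s i)))).
apply: (@le_trans _ _ ((\sum_(0 <= k < M)
   (\sum_(0 <= i < n) `|hdot (k%:R * a) (e i)|) / 2) * (2 * sin (a / 2)))).
  by rewrite ler_wpM2r ?mulr_ge0// ler_sum_nat// => k /andP[_]; exact: width.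
(* After the exchange each chord is seen from all directions; the half coming from the double
   crossing cancels the factor 2 of [sum_abs_hdot]. *)
rewrite -mulr_suml exchange_big/= mulrAC.
rewrite ler_pdivrMr// mulr_suml mulr_suml; apply: ler_sum => i _.
by rewrite [leRHS]mulrC; exact: sum_abs_hdot.
Qed.

End Perimeter.

(** * Inradius *)

Section Inradius.
Variables (R : realType) (X : set (pt R)).
Hypotheses (cX : compact X) (X0 : X !=set0).

(** Inclusion of a ball expressed by supporting half-planes, the form that compares with polygons.
    [inball_disk] recovers the actual inclusion from convexity. *)
Definition inball (z : pt R) (r : R) :=
  forall th, 0 <= th <= 2 * pi -> hdot th z + r <= supp X th.

(** Signed distance to the nearest supporting line; [inball z r] is the condition [r <= depth z]. *)
Definition depth (z : pt R) : R :=
  inf [set supp X th - hdot th z | th in `[0, 2 * pi]].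

Lemma norm_hdot_le th (p : pt R) : `|hdot th p| <= `|p.1| + `|p.2|.
Proof.
apply: (le_trans (ler_normD _ _)); rewrite !normrM; apply: lerD.
  by rewrite ler_piMr// cos_max.
by rewrite ler_piMr// sin_max.
Qed.

Lemma depth_has_inf z : has_inf [set supp X th - hdot th z | th in `[0, 2 * pi]].
Proof.
have pi0 := pi_gt0 R.
split.
  by exists (supp X 0 - hdot 0 z), 0 => //=; rewrite in_itv/=; lra.
move: X0 => [p Xp]; exists (- (`|p.1 - z.1| + `|p.2 - z.2|)) => _ [th _ <-].
have := hdot_le_supp cX X0 th Xp.
have := norm_hdot_le th (p.1 - z.1, p.2 - z.2); rewrite ler_norml/= => /andP[+ _].
have -> : hdot th (p.1 - z.1, p.2 - z.2) = hdot th p - hdot th z.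
  by rewrite /hdot/=; ring.
lra.
Qed.

Lemma inball_depth z r : inball z r <-> r <= depth z.
Proof.
have hi := depth_has_inf z; split => [h|h th hth].
  apply: (lb_le_inf hi.1) => _ [th + <-].
  by rewrite /= in_itv/= => /h; lra.
rewrite addrC -lerBrDr; apply: (le_trans h); apply: (ge_inf hi.2).
by exists th => //=; rewrite in_itv.
Qed.

Lemma depth_lip z w : depth z <= depth w + (`|z.1 - w.1| + `|z.2 - w.2|).
Proof.
rewrite -lerBlDr; apply/inball_depth => th hth.
have /inball_depth /(_ _ hth) := lexx (depth z).
have := norm_hdot_le th (z.1 - w.1, z.2 - w.2); rewrite ler_norml/= => /andP[+ _].
have -> : hdot th (z.1 - w.1, z.2 - w.2) = hdot th z - hdot th w.
  by rewrite /hdot/=; ring.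
lra.
Qed.

Lemma continuous_depth : continuous (depth : R * R -> R).
Proof.
move=> z; apply/cvgrPdist_le => e e0.
have e20 : 0 < e / 2 by rewrite divr_gt0.
have := @nbhsx_ballx R (R * R)%type (z : R * R) (e / 2) e20.
apply: filterS.
move=> w [/= /ltW hw1 /ltW hw2].
have a1 := depth_lip z w; have a2 := depth_lip w z.
rewrite [in X in _ <= _ + X]distrC [in X in _ + (_ + X)]distrC in a2.
rewrite ler_norml; lra.
Qed.

(** [depth] is continuous, hence has a maximum on a square containing [X], and it is nonnegative
    there. A point of positive depth lies in the square, by the inequalities in the four axis
    directions, so the maximum is global. *)
Lemma inradius_exists : exists (z : pt R) (r : R), [/\ 0 <= r, inball z r &
  forall z' r', inball z' r' -> r' <= r].
Proof.
have pi0 := pi_gt0 R.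
have [M M0 hM] := bounded_coords cX.
pose C : set (R * R) := `[- M, M] `*` `[- M, M].
have cC : compact C by apply: compact_setX; exact: segment_compact.
have [p0 Xp0] := X0.
have XC p : X p -> C p.
  by move=> /hM[h1 h2]; split; rewrite /= in_itv/= -ler_norml.
have [z] := compact_EVT_max (ex_intro _ p0 (XC _ Xp0)) cC (continuous_subspaceT continuous_depth).
rewrite inE => Cz hz.
have d0 : 0 <= depth z.
  apply: le_trans (hz p0 _); last by rewrite inE; exact: XC.
  by apply/inball_depth => th _; rewrite addr0; exact: hdot_le_supp.
exists z, (depth z); split => //; first exact/inball_depth.
move=> z' r' hr; have [r0|r0] := leP r' 0; first exact: le_trans d0.
have sM th : (forall p : pt R, `|p.1| <= M -> `|p.2| <= M -> hdot th p <= M) -> supp X th <= M.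
  move=> h; have [q Xq [<- _]] := supp_attained cX X0 th.
  by have [? ?] := hM _ Xq; exact: h.
suff Cz' : C z'.
  by apply: le_trans (hz z' _); [exact/inball_depth|rewrite inE].
have e1 : z'.1 <= M.
  have := hr 0; rewrite hdot0 => h; have : 0 <= (0 : R) <= 2 * pi by rewrite lexx mulr_ge0// pi_ge0.
  have := sM 0; move=> h2 /h.
  have : supp X 0 <= M.
    by apply: h2 => p; rewrite hdot0 ler_norml => /andP[].
  lra.
have e2 : z'.2 <= M.
  have := hr (pi / 2); rewrite /hdot cos_pihalf sin_pihalf mulr0 mulr1 add0r => h.
  have := sM (pi / 2); rewrite /hdot cos_pihalf sin_pihalf => h2.
  have : supp X (pi / 2) <= M.
    by apply: h2 => p _; rewrite mulr0 mulr1 add0r ler_norml => /andP[].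
  have : 0 <= (pi : R) / 2 <= 2 * pi by lra.
  move=> /h; lra.
have e3 : - M <= z'.1.
  have := hr pi; rewrite /hdot cospi sinpi mulr0 mulrN1 addr0 => h.
  have := sM pi; rewrite /hdot cospi sinpi => h2.
  have : supp X pi <= M.
    by apply: h2 => p + _; rewrite mulr0 mulrN1 addr0 ler_norml; lra.
  have : 0 <= (pi : R) <= 2 * pi by lra.
  move=> /h; lra.
have e4 : - M <= z'.2.
  pose t : R := pi / 2 + pi.
  have ct : cos t = 0 by rewrite cosDpi cos_pihalf oppr0.
  have st : sin t = -1 by rewrite sinDpi sin_pihalf.
  have := hr t; rewrite /hdot ct st mulr0 mulrN1 add0r => h.
  have := sM t; rewrite /hdot ct st => h2.
  have : supp X t <= M.
    by apply: h2 => p _; rewrite mulr0 mulrN1 add0r ler_norml; lra.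
  have : 0 <= t <= 2 * pi by rewrite /t; lra.
  move=> /h; lra.
by split; rewrite /= in_itv/=; lra.
Qed.


Lemma supp_step_periodic N : (4 < N)%N -> nperiodic N (fun k => supp X (k%:R * step R N)).
Proof. by move=> N4 k; rewrite natrD mulrDl N_step// suppD2pi. Qed.

(** Rounding an angle down to a multiple of the step changes [hdot] at [z] and the support function
    by at most [2 * M * step R N] each, hence the loss of [4 * M * step R N]. *)
Lemma inball_polygon N M z r : (4 < N)%N ->
  (forall p, X p -> `|p.1| <= M /\ `|p.2| <= M) ->
  `|z.1| <= M -> `|z.2| <= M ->
  polygon N (fun k => supp X (k%:R * step R N) - r) z ->
  inball z (r - 4 * M * step R N).
Proof.
move=> N4 hM z1 z2 hz th /andP[th0 _]; set a := step R N.
have a0 : 0 < a := step_gt0 R N4.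
pose k := Num.truncn (th / a).
have /truncn_itv/andP[k1 k2] : 0 <= th / a by rewrite divr_ge0// ltW.
have M0 : 0 <= M := le_trans (normr_ge0 _) z1.
have hk : `|th - k%:R * a| <= a.
  rewrite ler_pdivlMr// in k1; rewrite ltr_pdivrMr// -natr1 mulrDl mul1r in k2.
  by rewrite ler_norml; rewrite -/k in k1 k2; lra.
have h1 := hz k; rewrite /ndot -/a in h1.
have := hdot_lip th (k%:R * a) z1 z2; rewrite ler_norml => /andP[_ h2].
have h3 := supp_lip cX X0 (k%:R * a) th hM; rewrite distrC in h3.
have h4 : 2 * M * `|th - k%:R * a| <= 2 * M * a by rewrite ler_wpM2l// mulr_ge0.
lra.
Qed.

(** With [4 * K] directions the four axis directions are among them, at the indices 0, [K], [2 * K]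
    and [3 * K]. *)
Lemma polygon_supp_coords K M z r : (1 < K)%N ->
  (forall p, X p -> `|p.1| <= M /\ `|p.2| <= M) -> 0 <= r ->
  polygon (4 * K) (fun k => supp X (k%:R * step R (4 * K)) - r) z ->
  `|z.1| <= M /\ `|z.2| <= M.
Proof.
move=> K1 hM r0 hz; set a := step R (4 * K).
have N4 : (4 < 4 * K)%N by apply: leq_trans (leq_mul (leqnn 4) K1).
have Ka : K%:R * a = pi / 2 by have := N_step R N4; rewrite natrM -/a; lra.
have aux k : ndot (4 * K) k z <= supp X (k%:R * a).
  by apply: (le_trans (hz k)); rewrite gerBl.
have sM th : (forall p : pt R, `|p.1| <= M -> `|p.2| <= M -> hdot th p <= M) -> supp X th <= M.
  move=> h; have [q Xq [<- _]] := supp_attained cX X0 th.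
  by have [? ?] := hM _ Xq; exact: h.
have h0 := aux 0%N; have h1 := aux K; have h2 := aux (K + K)%N.
have h3 := aux (K + K + K)%N; rewrite /ndot -/a in h0 h1 h2 h3.
rewrite !natrD !mulrDl Ka in h1 h2 h3; rewrite mul0r in h0.
have pp : pi / 2 + pi / 2 = pi :> R by lra.
have hd1 p : hdot (pi / 2) p = p.2 :> R.
  by rewrite /hdot cos_pihalf sin_pihalf mulr0 mulr1 add0r.
have hd2 p : hdot pi p = - p.1 :> R.
  by rewrite /hdot cospi sinpi mulr0 mulrN1 addr0.
have hd3 p : hdot (pi + pi / 2) p = - p.2 :> R.
  by rewrite addrC hdotDpi hd1.
rewrite pp in h2 h3; rewrite hdot0 in h0; rewrite hd1 in h1; rewrite hd2 in h2.
rewrite hd3 in h3.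
have s0 : supp X 0 <= M by apply: sM => p; rewrite hdot0 !ler_norml; lra.
have s1 : supp X (pi / 2) <= M by apply: sM => p; rewrite hd1 !ler_norml; lra.
have s2 : supp X pi <= M by apply: sM => p; rewrite hd2 !ler_norml; lra.
have s3 : supp X (pi + pi / 2) <= M by apply: sM => p; rewrite hd3 !ler_norml; lra.
rewrite !ler_norml; lra.
Qed.

(** The circumscribed polygon is peeled in place of [X]. Its discrete inradius [rho] is close to
    [r]: a ball in the polygon nearly fits in [X], and the largest ball of [X] fits in the
    polygon. *)
Lemma area_supp K (d M r : R) z : (1 < K)%N -> 0 < d ->
  (forall p, X p -> `|p.1| <= M /\ `|p.2| <= M) ->
  inball z r -> (forall z' r', inball z' r' -> r' <= r) ->
  let a := step R (4 * K) in
  exists rho, [/\ 0 <= rho,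
    (area X <= ((rho + d) * (2 * tan (a / 2) *
        \sum_(0 <= k < 4 * K) supp X (k%:R * a)) - pi * rho ^+ 2)%R%:E)%E,
    rho <= r + 4 * M * a & r <= rho + d].
Proof.
move=> K1 d0 hM zr rmax a.
have N4 : (4 < 4 * K)%N by apply: leq_trans (leq_mul (leqnn 4) K1).
have oN : ~~ odd (4 * K) by rewrite oddM.
have hN := supp_step_periodic N4; rewrite -/a in hN.
have XP : X `<=` polygon (4 * K) (fun k => supp X (k%:R * a)).
  by move=> p Xp k; exact: hdot_le_supp.
have P0 : polygon (4 * K) (fun k => supp X (k%:R * a)) !=set0.
  by have [p Xp] := X0; exists p; exact: XP.
have [rho [rho0 [w Prho] Pd Ar]] := polygon_area N4 oN hN d0 P0.
exists rho; split => //.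
- apply: le_trans Ar; apply: le_measure => //; rewrite inE.
    exact: compact_measurable2.
  exact: measurable_polygon.
- have [w1 w2] := polygon_supp_coords K1 hM rho0 Prho.
  have := rmax _ _ (inball_polygon N4 hM w1 w2 Prho); rewrite -/a; lra.
(* If [rho + d < r], the incentre [z] would lie in the polygon at depth [rho + d], which is
   empty. *)
- rewrite leNgt; apply/negP => hr; apply: Pd; exists z => k.
  suff : ndot (4 * K) (k %% (4 * K)) z + r <= supp X ((k %% (4 * K))%:R * a).
    rewrite (nperiodic_mod k (ndot_periodic N4 z)) (nperiodic_mod k hN); lra.
  have h0 := step_gt0 R N4; rewrite -/a in h0.
  apply: zr; apply/andP; split; first by rewrite mulr_ge0// ltW.
  rewrite -(N_step R N4) -/a ler_wpM2r ?(ltW h0)// ler_nat ltnW// ltn_pmod//.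
  exact: leq_trans N4.
Qed.

End Inradius.

(** * The isoperimetric case of equality *)

Section Isoperimetric.
Variables (R : realType) (X : set (pt R)).
Hypotheses (cX : compact X) (X0 : X !=set0).

Lemma step4_le1 K : (1 < K)%N -> step R (4 * K) <= 1.
Proof.
move=> K1; have K2 : 2 <= K%:R :> R by rewrite ler_nat.
have pi2 := pihalf_lt2 R.
rewrite /step ler_pdivrMr ?mul1r ?ltr0n ?muln_gt0 ?(ltnW K1)// natrM; lra.
Qed.

(** The passage to the limit: [step R (4 * K)] is [pi / (2 * K)], so an archimedean choice of [K]
    makes the error smaller than a supposed gap [x - y]. *)
Lemma le_step_limit (x y Q : R) :
  (forall K, (1 < K)%N -> x <= y + step R (4 * K) * Q) -> x <= y.
Proof.
move=> h; rewrite leNgt; apply/negP => yx.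
have Q0 : 0 < Q.
  have N4 : (4 < 4 * 2)%N by [].
  rewrite -(pmulr_rgt0 _ (step_gt0 R N4)); have := h 2%N isT; lra.
have pi0 := pi_gt0 R.
pose K := (Num.truncn (pi * Q / (x - y))).+2.
have /h : (1 < K)%N by [].
have N4 : (4 < 4 * K)%N by apply: leq_trans (leq_mul (leqnn 4) (isT : (1 < K)%N)).
have : pi * Q / (x - y) < K%:R.
  by apply: lt_trans (truncnS_gt _) _; rewrite ltr_nat.
rewrite ltr_pdivrMr ?subr_gt0// => h1.
have := N_step R N4; rewrite natrM; set a := step R _ => h2.
have h3 : K%:R * a = pi / 2 by lra.
have K0 : 0 < K%:R :> R by rewrite ltr0n.
rewrite -lerBlDl -(ler_pM2l K0) mulrA h3.
have : 0 < pi * Q by rewrite mulr_gt0.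
lra.
Qed.

(** The first inequality reads [p r^2 <= (2 r - 1) A], which forces [r > 1/2]. Bounding [A] on its
    right side by the second one leaves [2 p r (r - 1)^2 <= 0]. *)
Lemma isoperimetric_equality (A r p : R) : 0 < A -> 0 <= r -> 0 < p ->
  A <= r * (2 * A) - p * r ^+ 2 -> A <= r * (2 * p) - p * r ^+ 2 ->
  r = 1 /\ A <= p.
Proof.
move=> A0 r0 p0 h1 h2.
have r2 : 1 / 2 < r.
  rewrite ltNge; apply/negP => hr.
  have : 0 <= A * (1 / 2 - r) by rewrite mulr_ge0 ?(ltW A0)//; lra.
  have pr2 : 0 <= p * r ^+ 2 by rewrite mulr_ge0 ?sqr_ge0 ?ltW.
  move=> h; have : p * r ^+ 2 <= 0 by lra.
  rewrite pmulr_rle0// => r2; have : r ^+ 2 == 0 by rewrite eq_le r2 sqr_ge0.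
  by rewrite sqrf_eq0 => /eqP r00; move: h1; rewrite r00 expr0n/=; lra.
have h3 : p * r * (r - 1) ^+ 2 <= 0.
  have : (2 * r - 1) * A <= (2 * r - 1) * (r * (2 * p) - p * r ^+ 2).
    by rewrite ler_wpM2l//; lra.
  rewrite !expr2 in h1 *; lra.
have pr : 0 < p * r by rewrite mulr_gt0//; lra.
have : (r - 1) ^+ 2 <= 0 by rewrite -(pmulr_rle0 _ pr).
move=> h4; have /eqP : (r - 1) ^+ 2 = 0 by apply/eqP; rewrite eq_le h4 sqr_ge0.
rewrite sqrf_eq0 subr_eq0 => /eqP r1; split => //.
by move: h2; rewrite r1 expr1n; lra.
Qed.

(** The [2 * K] directions of a half turn together with their opposites are the [4 * K] directions
    of the full turn. *)
Lemma perimeter_supp_sum K L : (1 < K)%N -> has_perimeter X L ->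
  2 * sin (step R (4 * K) / 2) *
    \sum_(0 <= k < 4 * K) supp X (k%:R * step R (4 * K)) <= L.
Proof.
move=> K1 hL; have K0 : (0 < 2 * K)%N by rewrite muln_gt0/= ltnW.
have := perimeter_ge cX X0 K0 hL.
have -> : pi / (2 * K)%:R = step R (4 * K).
  have K00 : K%:R != 0 :> R by rewrite pnatr_eq0 -lt0n ltnW.
  by rewrite /step !natrM; field.
set a := step R _.
have Ka : (2 * K)%:R * a = pi.
  have N4 : (4 < 4 * K)%N by apply: leq_trans (leq_mul (leqnn 4) K1).
  have := N_step R N4; rewrite -/a !natrM; lra.
congr (_ * _ <= _); rewrite big_split/=.
rewrite [RHS](big_cat_nat (n := (2 * K)%N))//=; last by rewrite leq_mul2r orbT.
congr (_ + _); rewrite -{2}[(2 * K)%N]add0n big_addn.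
have -> : (4 * K - 2 * K = 2 * K)%N by rewrite -mulnBl.
by apply: eq_bigr => k _; rewrite natrD mulrDl Ka.
Qed.

(* The polygon inequality in the limit: with m = min (2 A, 2 pi) one gets
   A <= m r - pi r^2, which forces r = 1. *)
Lemma extremal_inball (A C M : R) : area X = A%:E -> 0 < A -> 0 <= C -> 0 <= M ->
  (forall p, X p -> `|p.1| <= M /\ `|p.2| <= M) ->
  has_perimeter X (2 * pi) ->
  (forall K, (1 < K)%N -> 2 * step R (4 * K) *
    \sum_(0 <= k < 4 * K) supp X (k%:R * step R (4 * K)) <=
    4 * A + 2 * C * step R (4 * K)) ->
  A <= pi /\ exists z, inball X z 1.
Proof.
move=> AE A0 C0 M0 hM hL hN.
have [z [r [r0 zr rmax]]] := inradius_exists cX X0.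
have pi0 := pi_gt0 R.
suff key m : 0 <= m -> (forall K, (1 < K)%N ->
   2 * sin (step R (4 * K) / 2) *
    \sum_(0 <= k < 4 * K) supp X (k%:R * step R (4 * K)) <= m + C * step R (4 * K)) ->
   A <= r * m - pi * r ^+ 2.
  have h1 : A <= r * (2 * A) - pi * r ^+ 2.
    apply: key => [|K K1]; first lra.
    have N4 : (4 < 4 * K)%N by apply: leq_trans (leq_mul (leqnn 4) K1).
    have := hN _ K1; have := sin_half_step_gt0 R N4; have := step_gt0 R N4.
    set a := step R _; set Sg := \sum_(_ <= _ < _) _ => a0 s0 h.
    (* The hypothesis bounds [2 * a * Sg], which dominates [4 * sin (a / 2) * Sg] when [Sg] is
       nonnegative; for negative [Sg] the bound holds by sign. *)
    have sa : sin (a / 2) <= a / 2 by apply: sin_le_id; lra.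
    have [Sg0|Sg0] := leP 0 Sg.
      have : sin (a / 2) * Sg <= a / 2 * Sg by rewrite ler_wpM2r.
      lra.
    have : sin (a / 2) * Sg <= 0 by rewrite pmulr_rle0// ltW.
    have : 0 <= C * a by rewrite mulr_ge0// ltW.
    lra.
  have h2 : A <= r * (2 * pi) - pi * r ^+ 2.
    apply: key => [|K K1]; first lra.
    have N4 : (4 < 4 * K)%N by apply: leq_trans (leq_mul (leqnn 4) K1).
    apply: le_trans (perimeter_supp_sum K1 hL) _.
    by rewrite lerDl mulr_ge0// ltW// step_gt0.
  have [r1 Api] := isoperimetric_equality A0 r0 pi0 h1 h2.
  by split => //; exists z; rewrite -r1.
move=> m0 hm.
(* The constant collects the first-order errors: [A / 2] from [cos (a / 2) >= 1 - a / 2], the next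
   group from expanding the product of [r + (4 * M + 1) * a] and [m + C * a], the last from
   replacing [rho] by [r] in the quadratic term. *)
apply: (@le_step_limit _ _ (A / 2 + (r * C + (4 * M + 1) * m + (4 * M + 1) * C)
  + pi * (2 * r + r ^+ 2 / 2))) => K K1.
have N4 : (4 < 4 * K)%N by apply: leq_trans (leq_mul (leqnn 4) K1).
have a0 := step_gt0 R N4; have a1 := step4_le1 K1; have T := hm K K1.
(* The layers are as thick as the angular step, so that a single parameter tends to zero. *)
have [rho [rho0 hA rho1 rho2]] := area_supp cX X0 K1 a0 hM zr rmax.
move: hA rho1 rho2 T a0 a1.
have c0 := cos_half_step_gt0 R N4.
have c1 : 1 - cos (step R (4 * K) / 2) <= step R (4 * K) / 2.
  have := cos_lip 0 (step R (4 * K) / 2); rewrite cos0 sub0r normrN.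
  have a20 : 0 <= step R (4 * K) / 2 by rewrite divr_ge0// ltW// step_gt0.
  by rewrite (ger0_norm a20); apply: le_trans (ler_norm _).
move: c0 c1; set a := step R _; set Sg := \sum_(_ <= _ < _) _.
set c := cos _ => c0 c1 hA rho1 rho2 T a0 a1.
rewrite AE lee_fin /tan -/c in hA.
set s := sin _ in hA T.
have h1 : A * c <= (rho + a) * (2 * s * Sg) - pi * rho ^+ 2 * c.
  have := ler_wpM2r (ltW c0) hA.
  have -> : ((rho + a) * (2 * (s / c) * Sg) - pi * rho ^+ 2) * c =
    (rho + a) * (2 * s * Sg) - pi * rho ^+ 2 * c by field; rewrite gt_eqF.
  by [].
have h2 : (rho + a) * (2 * s * Sg) <= (r + (4 * M + 1) * a) * (m + C * a).
  apply: (@le_trans _ _ ((rho + a) * (m + C * a))).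
    by rewrite ler_wpM2l// addr_ge0// ltW.
  rewrite ler_wpM2r//; last lra.
  by rewrite addr_ge0// mulr_ge0// ltW.
(* Only [r <= rho + a] is known; squaring [r - a] needs [a <= r], and otherwise the left side is not
   positive. *)
have h3 : r ^+ 2 - 2 * r * a <= rho ^+ 2.
  have [ra|ra] := leP a r.
    have : (r - a) ^+ 2 <= rho ^+ 2 by rewrite ler_sqr ?nnegrE//; lra.
    have := sqr_ge0 a; rewrite !expr2; lra.
  apply: (@le_trans _ _ 0); last exact: sqr_ge0.
  have : r * (r - 2 * a) <= 0 by rewrite mulr_ge0_le0//; lra.
  rewrite expr2; lra.
have c1' : c <= 1 by exact: cos_le1.
have c2 : 1 - a / 2 <= c by lra.
have h4 : A * (1 - a / 2) <= A * c by rewrite ler_wpM2l// ltW.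
have h5 : rho ^+ 2 * (1 - a / 2) <= rho ^+ 2 * c by rewrite ler_wpM2l// sqr_ge0.
have h6 : (r ^+ 2 - 2 * r * a) * (1 - a / 2) <= rho ^+ 2 * (1 - a / 2).
  by rewrite ler_wpM2r//; lra.
have h7 : 0 <= r * a * a by rewrite !mulr_ge0// ltW.
have h8 : r ^+ 2 - a * (2 * r + r ^+ 2 / 2) <= rho ^+ 2 * c by lra.
have h9 : pi * (r ^+ 2 - a * (2 * r + r ^+ 2 / 2)) <= pi * (rho ^+ 2 * c).
  by rewrite ler_wpM2l// ltW.
have h10 : (4 * M + 1) * C * (a * a) <= (4 * M + 1) * C * a.
  rewrite ler_wpM2l//; first by rewrite mulr_ge0//; lra.
  by rewrite ler_piMr// ltW.
lra.
Qed.

End Isoperimetric.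

(** * Area swept out by a translation *)

Section Needle.
Variable R : realType.
Local Notation mu := (@lebesgue_measure R).
Local Notation RR := (measurableTypeR R * measurableTypeR R)%type.

Lemma convex_setP (X : set (pt R)) p q t : convex_set X -> X p -> X q -> 0 <= t <= 1 ->
  X (t * p.1 + (1 - t) * q.1, t * p.2 + (1 - t) * q.2).
Proof.
move=> cX Xp Xq /andP[t0 t1].
have := cX p q (Itv01 t0 t1) (mem_set Xp) (mem_set Xq).
by rewrite inE.
Qed.

Lemma convex_setI (X : set (pt R)) :
  (forall p q t, X p -> X q -> 0 <= t <= 1 ->
    X (t * p.1 + (1 - t) * q.1, t * p.2 + (1 - t) * q.2)) -> convex_set X.
Proof.
move=> h p q t; rewrite !inE => Xp Xq.
have t01 : 0 <= t%:num <= 1 by rewrite ge0 le1.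
exact: h Xp Xq t01.
Qed.

(** By convexity a segment lies in [X] as soon as its endpoints do. *)
Lemma needle_inE (X : set (pt R)) x l th : convex_set X ->
  needle_in X x l th <-> X x /\ X (x.1 + l * cos th, x.2 + l * sin th).
Proof.
move=> cX; split => [h|[Xx Xl] t t01].
  split; first by have := h 0; rewrite !mul0r !addr0 lexx ler01 -surjective_pairing; exact.
  by have := h 1; rewrite !mul1r lexx ler01; exact.
have := convex_setP cX Xl Xx t01 => /=; congr X; congr pair; ring.
Qed.

Definition exit_set (X : set (pt R)) l th : set (pt R) :=
  [set p | X p /\ ~ X (p.1 + l * cos th, p.2 + l * sin th)].

Definition stay_set (X : set (pt R)) l th : set (pt R) :=
  [set p | X p /\ X (p.1 + l * cos th, p.2 + l * sin th)].

Lemma measurable_translate (X : set RR) (a b : R) : measurable X ->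
  measurable ([set p | X (p.1 + a, p.2 + b)] : set RR).
Proof.
move=> mX; have := measurable_preimage_affine 1 0 a 0 1 b mX.
by congr measurable; apply/seteqP; split => p /=; rewrite !(mul1r, mul0r, add0r, addr0).
Qed.

Lemma measurable_exit_set (X : set RR) l th : measurable X ->
  measurable (exit_set X l th : set RR).
Proof.
move=> mX; have -> : exit_set X l th = X `\` [set p | X (p.1 + l * cos th, p.2 + l * sin th)].
  by [].
by apply: measurableD => //; exact: measurable_translate.
Qed.

Lemma measurable_stay_set (X : set RR) l th : measurable X ->
  measurable (stay_set X l th : set RR).
Proof. by move=> mX; apply: measurableI => //; exact: measurable_translate. Qed.

Lemma area_stay_exit (X : set RR) l th : measurable X ->
  area X = (area (stay_set X l th) + area (exit_set X l th))%E.
Proof.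
move=> mX; rewrite addeC; apply: measureDI => //; exact: measurable_translate.
Qed.

(* The rotation that turns the needle direction into the second axis. *)
Definition needle_rot th : pt R -> pt R := plane_rot (sin th) (- cos th).

Lemma needle_rotE th q : needle_rot th q =
  (sin th * q.1 + cos th * q.2, - cos th * q.1 + sin th * q.2).
Proof. by rewrite /needle_rot /plane_rot mulNr opprK mulNr. Qed.

Lemma area_exit_set (X : set RR) l th : measurable X ->
  area (exit_set X l th) =
  area [set q | X (needle_rot th q) /\ ~ X (needle_rot th (q.1, q.2 + l))].
Proof.
move=> mX; have h : sin th ^+ 2 + (- cos th) ^+ 2 = 1.
  by rewrite sqrrN addrC cos2Dsin2.
apply: (etrans (esym (area_rot (measurable_exit_set l th mX) h))).
have E q : needle_rot th (q.1, q.2 + l) =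
    ((needle_rot th q).1 + l * cos th, (needle_rot th q).2 + l * sin th).
  by rewrite !needle_rotE/=; congr pair; ring.
by congr (area _); apply/seteqP; split => q /=; rewrite E.
Qed.

Lemma measurable_rot_exit (X : set RR) l th : measurable X ->
  measurable ([set q | X (needle_rot th q) /\ ~ X (needle_rot th (q.1, q.2 + l))] : set RR).
Proof.
move=> mX; have mY : measurable (needle_rot th @^-1` X : set RR).
  exact: measurable_rot.
have := measurableD mY (measurable_translate 0 l mY).
congr measurable; apply/seteqP; split => q /=; by rewrite addr0.
Qed.

(** Contracting the vertical diameter of an inner ball towards [T] by the ratio [s] keeps it in [Y]
    and leaves a chord of length [2 * rho * s]. *)
Lemma chord_exists (Y : set (pt R)) c T s rho l : convex_set Y ->
  Y (c.1, c.2 + rho) -> Y (c.1, c.2 - rho) -> Y T -> 0 <= s <= 1 ->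
  l <= 2 * rho * s ->
  exists y0 y1, [/\ Y (s * c.1 + (1 - s) * T.1, y0),
    Y (s * c.1 + (1 - s) * T.1, y1) & l <= y1 - y0].
Proof.
move=> cY Y1 Y0 YT s01 hl.
exists (s * (c.2 - rho) + (1 - s) * T.2), (s * (c.2 + rho) + (1 - s) * T.2).
split; [exact: (convex_setP cY Y0 YT)|exact: (convex_setP cY Y1 YT)|lra].
Qed.

(** In a vertical slice of length at least [l], the points within [l] of the top are those that
    leave. The open interval avoids the question whether the supremum is attained. *)
Lemma exit_section_ge (Y : set (pt R)) x y0 y1 l b : convex_set Y -> 0 < l ->
  Y (x, y0) -> Y (x, y1) -> l <= y1 - y0 -> (forall y, Y (x, y) -> y <= b) ->
  exists m, `]m - l, m[ `<=` [set y | Y (x, y) /\ ~ Y (x, y + l)].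
Proof.
move=> cY l0 Y0 Y1 hl hb.
pose S := [set y | Y (x, y)].
have hs : has_sup S by split; [exists y1|exists b => y; exact: hb].
exists (sup S) => y; rewrite /= in_itv/= => /andP[ym1 ym2]; split.
  have [z Sz yz] := sup_gt hs.1 ym2.
  have m1 : y1 <= sup S by apply: (ub_le_sup hs.2).
  have yy0 : y0 <= y by lra.
  have zy0 : 0 < z - y0 by lra.
  have t01 : 0 <= (y - y0) / (z - y0) <= 1.
    by rewrite divr_ge0 ?ler_pdivrMr ?mul1r// ?(ltW zy0)//; lra.
  have := convex_setP cY Sz Y0 t01 => /=; congr (Y (_, _)); first by ring.
  by field; rewrite gt_eqF.
move=> /(ub_le_sup hs.2); lra.
Qed.

Lemma needle_rot_frame th p : needle_rot th (hdot (th - pi / 2) p, hdot th p) = p.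
Proof.
rewrite needle_rotE/= /hdot cosBpihalf sinBpihalf; case: p => a b /=.
have h := cos2Dsin2 th.
by congr pair; [rewrite -[RHS]mul1r -h|rewrite -[RHS]mul1r -h]; ring.
Qed.

Lemma hdot_needle_rot th q : hdot th (needle_rot th q) = q.2.
Proof.
rewrite needle_rotE /hdot/=; have h := cos2Dsin2 th.
by rewrite -[RHS]mul1r -h; ring.
Qed.

(** The sum of the two support values is the width across the needle. Slices parallel to the needle
    lose length [l] each, except near the two extremes, where they may be shorter than [l]. At
    distance at least [2 * M / rho * l] from both extremes they are long enough, by the cone from
    the extreme point over the inner ball. *)
Lemma exit_area_ge (X : set (pt R)) M c rho l th :
  compact X -> convex_set X -> 0 < M ->
  (forall p, X p -> `|p.1| <= M /\ `|p.2| <= M) -> 0 < rho ->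
  (forall ph, X (c.1 + rho * cos ph, c.2 + rho * sin ph)) -> X c -> 0 < l ->
  ((l * (supp X (th - pi / 2) + supp X (th + pi / 2) - 2 * (2 * M / rho) * l))%:E
   <= area (exit_set X l th))%E.
Proof.
move=> kX cX M0 hM rho0 hb Xc l0; have X0 : X !=set0 by exists c.
have mX : measurable (X : set RR) := compact_measurable2 kX.
set ka := 2 * M / rho.
have ka0 : 0 < ka by rewrite divr_gt0// mulr_gt0.
pose a := - supp X (th + pi / 2) + ka * l.
pose b := supp X (th - pi / 2) - ka * l.
have -> : supp X (th - pi / 2) + supp X (th + pi / 2) - 2 * ka * l = b - a.
  by rewrite /a /b; ring.
(* For long needles no slice is left and the claimed bound is not positive. *)
have [ba|ab] := leP b a.
  by apply: (@le_trans _ _ 0%E) => //; rewrite lee_fin pmulr_rle0// subr_le0.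
rewrite area_exit_set//.
have -> : (l * (b - a))%:E = (l%:E * mu `]a, b[%classic)%E.
  by rewrite lebesgue_measure_itv/= lte_fin ab -EFinB -EFinM.
apply: product_measure1_ge => //; [exact: measurable_rot_exit|exact: ltW|].
suff main (x : R) : a < x -> x < b -> (l%:E <= mu (xsection
    [set q | X (needle_rot th q) /\ ~ X (needle_rot th (q.1, q.2 + l)%R)] x))%E.
  by move=> x /=; rewrite in_itv/= => /andP[]; exact: main.
move=> ax xb; pose Y : set (pt R) := needle_rot th @^-1` X.
have cY : convex_set Y.
  apply: convex_setI => p q t Yp Yq t01.
  have := convex_setP cX Yp Yq t01; rewrite /Y/preimage/= !needle_rotE/=.
  by congr X; congr pair; ring.
have YN p : X p -> Y (hdot (th - pi / 2) p, hdot th p).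
  by rewrite /Y /preimage/= needle_rot_frame.
have lipM p q : X p -> X q -> hdot (th - pi / 2) p - hdot (th - pi / 2) q <= 4 * M.
  move=> /hM[p1 p2] /hM[q1 q2].
  have := norm_hdot_le (th - pi / 2) p; have := norm_hdot_le (th - pi / 2) q.
  rewrite !ler_norml => /andP[? ?] /andP[? ?]; lra.
pose c' : pt R := (hdot (th - pi / 2) c, hdot th c).
have Yc1 : Y (c'.1, c'.2 + rho).
  have := YN _ (hb th); congr (Y (_, _)); rewrite /c' /hdot/=.
    by rewrite cosBpihalf sinBpihalf; ring.
  rewrite -[in RHS](mulr1 rho) -(cos2Dsin2 th); ring.
have Yc0 : Y (c'.1, c'.2 - rho).
  have := YN _ (hb (th + pi)); congr (Y (_, _)); rewrite /c' /hdot/= cosDpi sinDpi.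
    by rewrite cosBpihalf sinBpihalf; ring.
  rewrite -[in RHS](mulr1 rho) -(cos2Dsin2 th); ring.
(* This fixes [ka]: the centre and an extreme point differ by at most [4 * M] across the needle, so
   a slice at distance [ka * l] from the extreme has ratio [s] with [2 * rho * s >= l]. *)
have kM : 4 * M = 2 * rho * ka by rewrite /ka; field; rewrite gt_eqF.
have chord p : X p -> (exists s, [/\ 0 <= s <= 1, l <= 2 * rho * s &
     x = s * c'.1 + (1 - s) * hdot (th - pi / 2) p]) ->
   exists y0 y1, [/\ Y (x, y0), Y (x, y1) & l <= y1 - y0].
  move=> Xp [s [s01 hs ->]]; exact: (chord_exists cY Yc1 Yc0 (YN _ Xp) s01 hs).
have [y0 [y1 [Y0 Y1 hl]]] : exists y0 y1, [/\ Y (x, y0), Y (x, y1) & l <= y1 - y0].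
  (* The apex of the cone is the support point on the same side of the centre as the slice. *)
  have [cx|xc] := leP c'.1 x.
    have [T XT [hT _]] := supp_attained kX X0 (th - pi / 2).
    have h4 := lipM _ _ XT Xc; rewrite -/(c'.1) in h4.
    apply: (chord T XT); set t := hdot _ T in hT h4 *.
    have tx : ka * l < t - x by move: xb; rewrite /b -hT; lra.
    have kl : 0 < ka * l by rewrite mulr_gt0.
    have tc : 0 < t - c'.1 by lra.
    exists ((t - x) / (t - c'.1)); split.
    - apply/andP; split; first by rewrite divr_ge0 ?(ltW tc)//; lra.
      by rewrite ler_pdivrMr// mul1r; lra.
    - rewrite mulrA ler_pdivlMr//.
      have : l * (t - c'.1) <= l * (4 * M) by rewrite ler_wpM2l// ltW.
      have : rho * (ka * l) <= rho * (t - x) by rewrite ler_wpM2l// ltW.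
      rewrite kM; lra.
    - by field; rewrite gt_eqF.
  have [T XT [hT _]] := supp_attained kX X0 (th + pi / 2).
  have h4 := lipM _ _ Xc XT; rewrite -/(c'.1) in h4.
  have hT2 : hdot (th - pi / 2) T = - supp X (th + pi / 2).
    by rewrite -hT -[in RHS](subrK pi (th + pi / 2)) hdotDpi opprK; congr hdot; field.
  apply: (chord T XT); set t := hdot (th - pi / 2) T in hT2 h4 *.
  have tx : ka * l < x - t by move: ax; rewrite /a hT2; lra.
  have kl : 0 < ka * l by rewrite mulr_gt0.
  have tc : 0 < c'.1 - t by lra.
  exists ((x - t) / (c'.1 - t)); split.
  - apply/andP; split; first by rewrite divr_ge0 ?(ltW tc)//; lra.
    by rewrite ler_pdivrMr// mul1r; lra.
  - rewrite mulrA ler_pdivlMr//.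
    have : l * (c'.1 - t) <= l * (4 * M) by rewrite ler_wpM2l// ltW.
    have : rho * (ka * l) <= rho * (x - t) by rewrite ler_wpM2l// ltW.
    rewrite kM; lra.
  - by field; rewrite gt_eqF.
have yb y : Y (x, y) -> y <= 2 * M.
  rewrite /Y /preimage/= => Yy; have [h1 h2] := hM _ Yy.
  have := norm_hdot_le th (needle_rot th (x, y)); rewrite hdot_needle_rot/=.
  rewrite ler_norml => /andP[_]; lra.
have [m hm] := exit_section_ge cY l0 Y0 Y1 hl yb.
apply: (@le_trans _ _ (mu `]m - l, m[%classic)).
  by rewrite lebesgue_measure_itv/= lte_fin gtrBl l0 -EFinB lee_fin; lra.
apply: le_measure; rewrite ?inE//.
  by apply: measurable_xsection; exact: measurable_rot_exit.
by move=> y /hm; rewrite /xsection/= inE.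
Qed.

End Needle.

(** * The unit disk *)

Section UnitDisk.
Variable R : realType.
Local Notation mu := (@lebesgue_measure R).
Local Notation RR := (measurableTypeR R * measurableTypeR R)%type.

Lemma diskE (c : pt R) r p : 0 <= r ->
  disk c r p <-> (p.1 - c.1) ^+ 2 + (p.2 - c.2) ^+ 2 <= r ^+ 2.
Proof.
move=> r0; rewrite /disk /Defs.edist/=.
by rewrite -(enorm2 (p.1 - c.1, p.2 - c.2)) ler_sqr ?nnegrE ?enorm_ge0.
Qed.

Lemma unit_diskE (p : pt R) : unit_disk p <-> p.1 ^+ 2 + p.2 ^+ 2 <= 1.
Proof. by rewrite /unit_disk diskE// !subr0 expr1n. Qed.

Lemma measurable_disk (c : pt R) r : 0 <= r -> measurable (disk c r : set RR).
Proof.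
move=> r0.
have mf : measurable_fun [set: RR]
    (fun p : RR => ((p.1 - c.1) ^+ 2 + (p.2 - c.2) ^+ 2 : measurableTypeR R)).
  by apply: measurable_funD; apply: measurable_funX; apply: measurable_funB.
have := mf measurableT _ (measurable_itv `]-oo, r ^+ 2]).
rewrite setTI; congr measurable; apply/seteqP; split => p /=; rewrite in_itv/=.
  by move/diskE; exact.
by move/diskE; exact.
Qed.

Lemma convex_unit_disk : convex_set (@unit_disk R : set (pt R)).
Proof.
apply: convex_setI => p q t /unit_diskE hp /unit_diskE hq /andP[t0 t1].
apply/unit_diskE => /=.
have h1 : t * (p.1 ^+ 2 + p.2 ^+ 2) <= t * 1 by rewrite ler_wpM2l.
have h2 : (1 - t) * (q.1 ^+ 2 + q.2 ^+ 2) <= (1 - t) * 1.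
  by rewrite ler_wpM2l// subr_ge0.
have h3 : 0 <= t * (1 - t) * ((p.1 - q.1) ^+ 2 + (p.2 - q.2) ^+ 2).
  by rewrite !mulr_ge0 ?subr_ge0// addr_ge0// sqr_ge0.
lra.
Qed.

(** In the rotated frame the slices sit over [[-1, 1]], and on a slice [[-b, b]] the leaving points
    lie in the top segment of length [l]. *)
Lemma exit_area_unit_disk (l th : R) : 0 < l ->
  (area (exit_set (@unit_disk R) l th) <= (2 * l)%:E)%E.
Proof.
move=> l0; have mD := @measurable_disk (0, 0) 1 ler01.
rewrite area_exit_set//.
have -> : (2 * l)%:E = (l%:E * mu `[(-1)%R, 1%R]%classic)%E.
  rewrite lebesgue_measure_itv/= lte_fin ifT; last lra.
  by rewrite -EFinB -EFinM; congr EFin; ring.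
have rotD q : unit_disk (needle_rot th q) <-> q.1 ^+ 2 + q.2 ^+ 2 <= 1.
  rewrite unit_diskE needle_rotE/=.
  have -> : (sin th * q.1 + cos th * q.2) ^+ 2 + (- cos th * q.1 + sin th * q.2) ^+ 2
     = (cos th ^+ 2 + sin th ^+ 2) * (q.1 ^+ 2 + q.2 ^+ 2) by ring.
  by rewrite cos2Dsin2 mul1r.
apply: product_measure1_le => //; first exact: measurable_rot_exit.
  move=> x; rewrite /= in_itv/= => /andP[x1 x2].
  pose b := Num.sqrt (1 - x ^+ 2).
  have x21 : 0 <= 1 - x ^+ 2.
    have : 0 <= (1 - x) * (1 + x) by rewrite mulr_ge0//; lra.
    lra.
  have b0 : 0 <= b := sqrtr_ge0 _.
  have b2 : b ^+ 2 = 1 - x ^+ 2 by rewrite sqr_sqrtr.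
  have in_b y : (x ^+ 2 + y ^+ 2 <= 1) = (- b <= y <= b).
    by rewrite -ler_norml -[RHS]ler_sqr ?nnegrE// b2 real_normK ?num_real// lerBrDl.
  apply: (@le_trans _ _ (mu `](b - l), b]%classic)); last first.
    by rewrite lebesgue_measure_itv/= lte_fin gtrBl l0 -EFinB lee_fin; lra.
  apply: le_measure; rewrite ?inE//.
    by apply: measurable_xsection; exact: measurable_rot_exit.
  move=> y; rewrite /xsection/= inE/= => -[/rotD/=]; rewrite in_b => /andP[y1 y2].
  move=> h; rewrite in_itv/= y2 andbT ltNge; apply/negP => yl; apply: h.
  by apply/rotD => /=; rewrite in_b; lra.
move=> x; rewrite /= in_itv/= => hx; apply/seteqP; split => y //=.
rewrite /xsection/= inE/= => -[/rotD/= h _]; apply: hx.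
have x21 : x ^+ 2 <= 1 by have := sqr_ge0 y; lra.
by rewrite -ler_norml -ler_sqr ?nnegrE// real_normK ?num_real// expr1n.
Qed.

(** The antiderivative of the slice length of the disk; [asin] restricts it to the open interval. *)
Lemma is_derive_half_disk (x : R) : -1 < x < 1 ->
  is_derive x 1 (fun z : R => z * Num.sqrt (1 - z ^+ 2) + asin z)
    (2 * Num.sqrt (1 - x ^+ 2)).
Proof.
move=> x1; have [x0 xl] := andP x1.
have s0 : 0 < 1 - x ^+ 2.
  by have : 0 < (1 - x) * (1 + x) by [rewrite mulr_gt0; lra]; lra.
set s := Num.sqrt _.
have sp : 0 < s by rewrite sqrtr_gt0.
have s2 : s ^+ 2 = 1 - x ^+ 2 by rewrite sqr_sqrtr// ltW.
have d1 : is_derive x (1 : R) (fun z : R => 1 - z ^+ 2) (- (2 * x)).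
  have d : is_derive x (1 : R) (cst 1 - id ^+ 2 : R -> R) (- (2 * x)).
    by apply: is_derive_eq; rewrite sub0r expr1 [_ *: _]mulr1.
  exact: d.
have d2 : is_derive x (1 : R) (fun z : R => Num.sqrt (1 - z ^+ 2)) (- x / s).
  have dS := is_derive1_sqrt s0; rewrite -/s in dS.
  have d : is_derive x (1 : R) (Num.sqrt \o (fun z : R => 1 - z ^+ 2)) (- x / s).
    have H := @is_derive1_comp _ _ (fun z : R => 1 - z ^+ 2) x _ _ dS d1.
    by apply: (is_derive_eq H); field; rewrite gt_eqF.
  exact: d.
have d3 : is_derive x (1 : R) (fun z : R => z * Num.sqrt (1 - z ^+ 2)) (s - x ^+ 2 / s).
  have d : is_derive x (1 : R) (id * (fun z : R => Num.sqrt (1 - z ^+ 2)) : R -> R) (s - x ^+ 2 / s).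
    apply: (is_derive_eq (is_deriveM (is_derive_id x 1) d2)).
    rewrite -/s [_ *: 1]mulr1 [_ *: _]/=.
    rewrite [x *: _](_ : _ = x * (- x / s))//; field; by rewrite gt_eqF.
  exact: d.
have d4 := is_derive1_asin x1; rewrite -/s in d4.
apply: (is_derive_eq (is_deriveD d3 d4)).
apply: (mulIf (lt0r_neq0 sp)); rewrite mulrDl mulrBl !divfK ?gt_eqF// mulVf ?gt_eqF//.
by rewrite -!expr2 -mulrA -expr2 s2; ring.
Qed.

(** Truncating at abscissa [sin t] keeps away from the singular endpoints. The truncated area is
    [2 * (sin t * cos t + t)], and the nonnegative first term is dropped. *)
Lemma area_unit_disk_ge (t : R) : 0 < t < pi / 2 -> ((2 * t)%:E <= area (@unit_disk R))%E.
Proof.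
move=> /andP[t0 t1].
have c0 : 0 < cos t by apply: cos_gt0_pihalf; lra.
have a0 : 0 < sin t by apply: sin_gt0_pihalf; rewrite t0.
have a1 : sin t < 1.
  rewrite lt_neqAle sin_le1 andbT; apply/eqP => h.
  have := cos2Dsin2 t; have : 0 < cos t ^+ 2 by rewrite exprn_gt0.
  rewrite h expr1n; lra.
pose a := sin t; rewrite -/a in a0 a1.
pose F (z : R) := z * Num.sqrt (1 - z ^+ 2) + asin z.
pose f (z : R) := 2 * Num.sqrt (1 - z ^+ 2).
have dF (x : R) : -1 < x < 1 -> is_derive x 1 F (f x) by exact: is_derive_half_disk.
have cF (x : R) : -1 < x < 1 -> {for x, continuous F}.
  by move=> /dF d; apply: differentiable_continuous; apply/derivable1_diffP; exact: ex_derive.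
have cf : continuous f.
  move=> x; apply: cvgMr; apply: (cvg_comp _ Num.sqrt); last exact: sqrt_continuous.
  by apply: cvgB; [exact: cvg_cst|apply: exprn_continuous].
have aa : - a < a by lra.
have FTC := continuous_FTC2 aa (continuous_subspaceT cf).
have FE : F a - F (- a) = 2 * (a * Num.sqrt (1 - a ^+ 2) + t).
  have aN : asin (- a) = - t by rewrite /a -sinN sinK// in_itv/=; lra.
  have aP : asin a = t by rewrite /a sinK// in_itv/=; lra.
  by rewrite /F sqrrN aN aP; ring.
have Fint : (\int[mu]_(x in `[(- a)%R, a]) (f x)%:E = (F a)%:E - (F (- a)%R)%:E)%E.
  have inI z : z \in `]- a, a[ -> -1 < z < 1.
    by rewrite in_itv/= => /andP[h1 h2]; lra.
  apply: FTC.
    split.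
    - by move=> z /inI /dF d; exact: ex_derive.
    - by apply: cvg_at_right_filter; apply: cF; lra.
    - by apply: cvg_at_left_filter; apply: cF; lra.
  by move=> z /inI /dF d; rewrite derive1E derive_val.
apply: (@le_trans _ _ (\int[mu]_(x in `[(- a)%R, a]) (f x)%:E)%E).
  rewrite Fint -EFinB FE lee_fin.
  have : 0 <= a * Num.sqrt (1 - a ^+ 2) by rewrite mulr_ge0 ?sqrtr_ge0// ltW.
  lra.
have mD := @measurable_disk (0, 0) 1 ler01.
have mxs := measurable_fun_xsection mu mD.
rewrite /area /product_measure1.
apply: (@le_trans _ _ (\int[mu]_(x in `[(- a)%R, a]) mu (xsection (@unit_disk R) x))%E).
  apply: ge0_le_integral => //.
  - by move=> x _; rewrite lee_fin mulr_ge0// sqrtr_ge0.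
  - apply/measurable_EFinP; apply: measurable_funTS.
    exact: continuous_measurable_fun.
  - by apply: measurable_funTS.
  move=> x; rewrite /= in_itv/= => /andP[x1 x2].
  pose b := Num.sqrt (1 - x ^+ 2).
  have x21 : 0 <= 1 - x ^+ 2.
    have : 0 <= (1 - x) * (1 + x) by rewrite mulr_ge0//; lra.
    lra.
  have b0 : 0 <= b := sqrtr_ge0 _.
  have b2 : b ^+ 2 = 1 - x ^+ 2 by rewrite sqr_sqrtr.
  apply: (@le_trans _ _ (mu `[(- b), b]%classic)).
    rewrite lebesgue_measure_itv/= lte_fin; case: ltP => h.
      by rewrite -EFinB lee_fin /f -/b; lra.
    by rewrite lee_fin /f -/b; lra.
  apply: le_measure; rewrite ?inE//; first exact: measurable_xsection.
  move=> y; rewrite /= in_itv/= -ler_norml => hy; rewrite /xsection/= inE.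
  apply/unit_diskE => /=.
  have : y ^+ 2 <= b ^+ 2 by rewrite -[y ^+ 2]real_normK ?num_real// ler_sqr ?nnegrE.
  by rewrite b2; lra.
by apply: ge0_subset_integral.
Qed.

Lemma area_unit_disk_ge_pi : (pi%:E <= area (@unit_disk R))%E.
Proof.
have pi0 := pi_gt0 R.
rewrite leNgt; apply/negP => h.
have fD : area (@unit_disk R) \is a fin_num.
  by rewrite ge0_fin_numE//; exact: lt_trans h (ltry _).
rewrite -(fineK fD) lte_fin in h; set A := fine _ in h.
have A0 : 0 <= A by apply: fine_ge0.
(* If [A < pi], then [2 * t] lies strictly between [A] and [pi]. *)
pose t := (A + pi) / 4.
have /area_unit_disk_ge : 0 < t < pi / 2 by rewrite /t; lra.
by rewrite -(fineK fD) lee_fin -/A /t; lra.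
Qed.

End UnitDisk.

(** * Needles and Fubini *)

Section Fubini.
Variable R : realType.
Local Notation mu := (@lebesgue_measure R).
Local Notation RR := (measurableTypeR R * measurableTypeR R)%type.
Local Notation vol := (@plane_area R).

(** Only the endpoints are constrained: this is measurable for measurable [X], and for convex [X] it
    agrees with [needle_in]. *)
Definition needle_set (X : set (pt R)) (l : R) : set (pt R * R) :=
  [set z | [/\ 0 <= z.2 < 2 * pi, X z.1 &
     X (z.1.1 + l * cos z.2, z.1.2 + l * sin z.2)]].

Lemma measurable_needle_set (X : set RR) l : measurable X ->
  measurable (needle_set X l : set (RR * measurableTypeR R)).
Proof.
move=> mX.
have mcos : measurable_fun [set: measurableTypeR R] (cos : R -> R).
  by apply: continuous_measurable_fun; exact: continuous_cos.
have msin : measurable_fun [set: measurableTypeR R] (sin : R -> R).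
  by apply: continuous_measurable_fun; exact: continuous_sin.
have m1 : measurable_fun [set: RR * measurableTypeR R]
    (fun z : RR * measurableTypeR R => z.1.1).
  by apply: measurableT_comp.
have m2 : measurable_fun [set: RR * measurableTypeR R]
    (fun z : RR * measurableTypeR R => z.1.2).
  by apply: measurableT_comp.
have mf : measurable_fun [set: RR * measurableTypeR R]
    (fun z : RR * measurableTypeR R =>
      ((z.1.1 + l * cos z.2 : measurableTypeR R), (z.1.2 + l * sin z.2 : measurableTypeR R)) : RR).
  apply: measurable_fun_pair; apply: measurable_funD => //; apply: measurable_funM => //.
    by apply: (measurableT_comp mcos).
  by apply: (measurableT_comp msin).
have h1 := mf measurableT _ mX; rewrite setTI in h1.
have h2 := measurableX mX (measurable_itv (`[0, (2 * pi)%R[ : interval R)).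
have := measurableI _ _ h1 h2; congr measurable.
apply/seteqP; split => z /=; rewrite in_itv/=.
  by move=> [? [? ?]].
by move=> [? ? ?].
Qed.

Lemma xsection_needle_set (X : set (pt R)) l p : convex_set X -> X p ->
  xsection (needle_set X l) p =
  [set th | `[0, 2 * pi[%classic th /\ needle_in X p l th].
Proof.
move=> cX Xp; apply/seteqP; split => th; rewrite /xsection/= inE/= in_itv/=.
  by move=> [h1 h2 h3]; split => //; apply/needle_inE.
by move=> [h1 /(needle_inE _ _ _ cX)[]].
Qed.

Lemma lebesgue_measure_turn : mu `[0%R, (2 * pi)%R[%classic = (2 * pi)%:E.
Proof.
have pi0 := pi_gt0 R.
by rewrite lebesgue_measure_itv/= lte_fin mulr_gt0// -EFinB subr0.
Qed.

Lemma needle_set_le (X : set RR) l : measurable X ->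
  ((vol \x mu) (needle_set X l) <= (2 * pi)%:E * vol X)%E.
Proof.
move=> mX; have mE := measurable_needle_set l mX.
refine (@product_measure1_le _ _ _ _ R vol mu (needle_set X l) X _ mE mX _ _).
  move=> p _; rewrite -lebesgue_measure_turn; apply: le_measure; rewrite ?inE//.
    exact: measurable_xsection.
  by move=> th; rewrite /xsection/= inE/= in_itv/= => -[].
move=> p hp; apply/seteqP; split => // th; rewrite /xsection/= inE/= => -[_ Xp _].
exact: hp.
Qed.

Lemma buffon_probE (X : set RR) l A : measurable X -> convex_set (X : set (pt R)) ->
  area X = A%:E ->
  exists2 V, (vol \x mu)%E (needle_set X l) = V%:E &
    buffon_prob X l = V / (2 * pi * A).
Proof.
move=> mX cX AE; have pi0 := pi_gt0 R; have mE := measurable_needle_set l mX.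
(* [fine] sends infinite values to 0, so finiteness comes first. *)
have fin : (vol \x mu)%E (needle_set X l) \is a fin_num.
  rewrite ge0_fin_numE//; apply: le_lt_trans (needle_set_le l mX) _.
  by rewrite [vol X](AE : vol X = _) -EFinM ltry.
exists (fine ((vol \x mu)%E (needle_set X l))); first by rewrite fineK.
rewrite /buffon_prob AE/=.
have mxs := measurable_fun_xsection mu mE.
set I := (\int[_]_(p in X) _)%E.
have -> : (I =
    ((2 * pi)^-1)%:E * (vol \x mu) (needle_set X l))%E.
  rewrite [in RHS]/product_measure1 /I.
  transitivity (\int[vol]_(p in X) (((2 * pi)^-1)%:E * mu (xsection (needle_set X l) p)))%E.
    apply: eq_integral => p; rewrite inE => Xp.
    rewrite /pointwise_prob -xsection_needle_set// mulrC EFinM fineK//.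
    rewrite ge0_fin_numE//; apply: (@le_lt_trans _ _ (2 * pi)%:E); last exact: ltry.
    rewrite -lebesgue_measure_turn; apply: le_measure; rewrite ?inE//.
      exact: measurable_xsection.
    by move=> th; rewrite /xsection/= inE/= in_itv/= => -[].
  rewrite ge0_integralZl//; last 2 first.
    by apply: measurable_funTS.
    by rewrite lee_fin invr_ge0 mulr_ge0// ltW.
  congr (_ * _)%E; rewrite integral_mkcond; apply: eq_integral => p _ /=.
  rewrite /patch; case: ifPn => //; rewrite notin_setE => Xp.
  rewrite (_ : xsection _ p = set0) ?measure0//.
  by apply/seteqP; split => // th; rewrite /xsection/= inE/= => -[].
rewrite -(fineK fin) -EFinM/=.
by rewrite [in RHS]invfM mulrA [X in X / _]mulrC.
Qed.

End Fubini.

Section BuffonBounds.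
Variable R : realType.
Local Notation mu := (@lebesgue_measure R).
Local Notation RR := (measurableTypeR R * measurableTypeR R)%type.
Local Notation vol := (@plane_area R).

(** Slicing by angle instead of by point: each angle keeps an area of at least [A - m]. *)
Lemma needle_set_ge (X : set RR) l A m : measurable X -> area X = A%:E ->
  m <= A -> (forall th, (area (exit_set X l th) <= m%:E)%E) ->
  (((A - m) * (2 * pi))%:E <= (vol \x mu) (needle_set X l))%E.
Proof.
move=> mX AE mA hm; rewrite EFinM -lebesgue_measure_turn.
have mE := measurable_needle_set l mX.
refine (@product_measure2_ge _ _ _ _ R vol mu (needle_set X l) _ (A - m) mE _ _ _) => //.
  by rewrite subr_ge0.
move=> th; rewrite /= in_itv/= => hth.
have -> : ysection (needle_set X l) th = stay_set X l th.
  apply/seteqP; split => p; rewrite /ysection/= inE/=; first by move=> [].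
  by move=> [? ?].
have := area_stay_exit l th mX; rewrite AE => E.
have fx : area (exit_set X l th) \is a fin_num.
  by rewrite ge0_fin_numE//; apply: le_lt_trans (hm th) (ltry _).
have := hm th; rewrite EFinB E -(fineK fx) lee_fin => h.
by rewrite -[leRHS](addeK _ (isT : (fine (area (exit_set X l th)))%:E \is a fin_num)) leeB// lee_fin.
Qed.

Lemma sum_width_supp (X : set (pt R)) K : (1 < K)%N ->
  let a := step R (4 * K) in
  \sum_(0 <= k < 4 * K) (supp X (k%:R * a - pi / 2) + supp X (k%:R * a + pi / 2)) =
  2 * \sum_(0 <= k < 4 * K) supp X (k%:R * a).
Proof.
move=> K1 a; have N4 : (4 < 4 * K)%N by apply: leq_trans (leq_mul (leqnn 4) K1).
have hN := supp_step_periodic X N4; rewrite -/a in hN.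
have Ka : K%:R * a = pi / 2 by have := N_step R N4; rewrite natrM -/a; lra.
rewrite big_split/= mulr_natl mulr2n; congr (_ + _).
  (* A quarter turn backwards is a shift of the index by [3 * K], since indices are naturals. *)
  rewrite -(sum_nperiodic_shift (3 * K) hN); apply: eq_bigr => k _.
  have K3 : (3 * K)%:R * a = 3 * (pi / 2) by rewrite natrM -mulrA Ka.
  by rewrite natrD [in RHS]mulrDl K3 -[LHS]suppD2pi; congr supp; field.
rewrite -(sum_nperiodic_shift K hN); apply: eq_bigr => k _.
by rewrite natrD [in RHS]mulrDl Ka.
Qed.

(** The angles are cut into sectors of size [a], and in each the width is compared with that at its
    left end. Each of its two support values varies by at most [2 * M * a], hence [4 * M * a];
    summed over the sectors, the widths give twice the support sum. *)
Lemma needle_set_upper (X : set (pt R)) A M c rho l K (a := step R (4 * K)) :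
  compact X -> convex_set X -> area X = A%:E -> 0 < M ->
  (forall p, X p -> `|p.1| <= M /\ `|p.2| <= M) -> 0 < rho ->
  (forall ph, X (c.1 + rho * cos ph, c.2 + rho * sin ph)) -> X c -> 0 < l ->
  (1 < K)%N ->
  ((vol \x mu) (needle_set X l) <=
   (2 * pi * A - l * (2 * a * \sum_(0 <= k < 4 * K) supp X (k%:R * a) -
      2 * pi * (4 * M * a + 2 * (2 * M / rho) * l)))%R%:E)%E.
Proof.
move=> kX cX AE M0 hM rho0 hb Xc l0 K1; have X0 : X !=set0 by exists c.
have N4 : (4 < 4 * K)%N by apply: leq_trans (leq_mul (leqnn 4) K1).
pose N := (4 * K)%N; rewrite -/N in N4.
have mX := compact_measurable2 kX; have mE := measurable_needle_set l mX.
have a0 : 0 < a := step_gt0 R N4.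
have Na : N%:R * a = 2 * pi := N_step R N4.
set ka := 2 * M / rho.
pose w k := supp X (k%:R * a - pi / 2) + supp X (k%:R * a + pi / 2).
pose I k : set R := `[k%:R * a, k.+1%:R * a[%classic.
pose E k := needle_set X l `&` (setT `*` I k).
have mI k : measurable (I k : set (measurableTypeR R)) by exact: measurable_itv.
have mEk k : measurable (E k : set (RR * measurableTypeR R)).
  by apply: measurableI => //; apply: measurableX.
have cover : needle_set X l `<=` \big[setU/set0]_(k < N) E k.
  move=> z hz; have [/andP[z0 z1] _ _] := hz.
  pose k := Num.truncn (z.2 / a).
  have /truncn_itv/andP[] : 0 <= z.2 / a by rewrite divr_ge0// ltW.
  rewrite -/k ler_pdivlMr// ltr_pdivrMr// => k1 k2.
  have kN : (k < N)%N.
    by rewrite -(ltr_nat R) -(ltr_pM2r a0) Na; exact: le_lt_trans k1 z1.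
  apply: (bigsetU_sup (F := E) kN); split => //; split => //=.
  by rewrite /I/= in_itv/= k1 k2.
apply: (@le_trans _ _ (\sum_(k < N) (vol \x mu) (E k))%E).
  by apply: content_subadditive.
pose e k := (A - l * (w k - 4 * M * a - 2 * ka * l)) * a.
apply: (@le_trans _ _ (\sum_(k < N) (e k)%:E)%E).
  apply: lee_sum => k _; rewrite /e EFinM.
  have -> : a%:E = mu (I k).
    rewrite lebesgue_measure_itv/= lte_fin ltr_pM2r// ltr_nat ltnSn -EFinB.
    by congr EFin; rewrite -natr1; ring.
  refine (@product_measure2_le _ _ _ _ R vol mu (E k) (I k)
    (A - l * (w k - 4 * M * a - 2 * ka * l)) (mEk k) (mI k) _ _) => th.
    rewrite /I/= in_itv/= => /andP[t1 t2].
    apply: (@le_trans _ _ (area (stay_set X l th))).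
      apply: le_measure; rewrite ?inE//.
      - by apply: measurable_ysection; exact: mEk.
      - exact: measurable_stay_set.
      - by move=> p; rewrite /ysection/= inE/= => -[[_ ? ?] _].
    have := area_stay_exit l th mX; rewrite AE => EA.
    have fs : area (stay_set X l th) \is a fin_num.
      rewrite ge0_fin_numE//; apply: (@le_lt_trans _ _ A%:E); last exact: ltry.
      by rewrite EA leeDl.
    have fx : area (exit_set X l th) \is a fin_num.
      rewrite ge0_fin_numE//; apply: (@le_lt_trans _ _ A%:E); last exact: ltry.
      by rewrite EA leeDr.
    have h := exit_area_ge th kX cX M0 hM rho0 hb Xc l0.
    move: EA h; rewrite -(fineK fs) -(fineK fx) -EFinD !lee_fin => -[EA].
    have s1 := supp_lip kX X0 (k%:R * a - pi / 2) (th - pi / 2) hM.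
    have s2 := supp_lip kX X0 (k%:R * a + pi / 2) (th + pi / 2) hM.
    have d1 : `|k%:R * a - pi / 2 - (th - pi / 2)| <= a.
      rewrite -natr1 in t2; rewrite ler_norml; lra.
    have d2 : `|k%:R * a + pi / 2 - (th + pi / 2)| <= a.
      rewrite -natr1 in t2; rewrite ler_norml; lra.
    have M2 : 0 <= 2 * M by rewrite mulr_ge0// ltW.
    have e1 := ler_wpM2l M2 d1; have e2 := ler_wpM2l M2 d2.
    have : l * (w k - 4 * M * a) <= l * (supp X (th - pi / 2) + supp X (th + pi / 2)).
      by rewrite ler_wpM2l ?(ltW l0)// /w; lra.
    rewrite -/ka; lra.
  move=> hth; apply/seteqP; split => p //; rewrite /ysection/= inE/=.
  by move=> [_ [_ ?]]; exact: hth.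
rewrite sumEFin lee_fin -(big_mkord xpredT e) /e -mulr_suml sumrB -mulr_sumr.
rewrite !sumrB sum_width_supp// -/a -/N !big_const_nat !iter_addr_0 subn0.
rewrite -/a -(mulr_natr A) -(mulr_natr (4 * _ * _)) -(mulr_natr (2 * ka * l)).
set S := \sum_(_ <= _ < _) _.
have -> : (A * N%:R - l * (2 * S - 4 * M * a * N%:R - 2 * ka * l * N%:R)) * a =
  A * (N%:R * a) - l * (2 * a * S - (N%:R * a) * (4 * M * a + 2 * ka * l)) by ring.
by rewrite Na; lra.
Qed.

End BuffonBounds.

(** * Comparison with the unit disk *)

Section EqualityCase.
Variables (R : realType) (X : set (pt R)).
Local Notation RR := (measurableTypeR R * measurableTypeR R)%type.

Lemma interior_square : interior X !=set0 -> exists (c : pt R) (e : R), 0 < e /\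
  forall p : pt R, `|p.1 - c.1| <= e -> `|p.2 - c.2| <= e -> X p.
Proof.
move=> [c]; rewrite /interior/= => -[[A B]] /=.
move=> [/nbhs_ballP[e1 /= e10 h1] /nbhs_ballP[e2 /= e20 h2]] hAB.
exists c, (Num.min e1 e2 / 2); split; first by rewrite divr_gt0// lt_min e10.
have e0 : 0 < Num.min e1 e2 by rewrite lt_min e10.
have [ee1 ee2] : Num.min e1 e2 <= e1 /\ Num.min e1 e2 <= e2.
  by rewrite !ge_min !lexx orbT.
move=> p p1 p2; apply: hAB; split => /=; [apply: h1|apply: h2];
  by rewrite /ball/= /ball_/= distrC; lra.
Qed.

Lemma square_area_le (c : pt R) (e : R) : measurable (X : set RR) -> 0 < e ->
  (forall p : pt R, `|p.1 - c.1| <= e -> `|p.2 - c.2| <= e -> X p) ->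
  (((2 * e) * (2 * e))%:E <= area X)%E.
Proof.
move=> mX e0 hX.
have -> : ((2 * e) * (2 * e))%:E =
    area (`[c.1 - e, c.1 + e] `*` `[c.2 - e, c.2 + e]).
  by rewrite area_rect; [congr EFin; ring|lra|lra].
apply: le_measure; rewrite ?inE//.
  by apply: measurableX; exact: measurable_itv.
by move=> p [/=]; rewrite !in_itv/= => h1 h2; apply: hX; rewrite ler_norml; lra.
Qed.

Lemma area_compact_fin : compact X -> area X \is a fin_num.
Proof.
move=> cX; have [M M0 hM] := bounded_coords cX.
have mX := compact_measurable2 cX.
rewrite ge0_fin_numE//; apply: (@le_lt_trans _ _ (area (`[- M, M] `*` `[- M, M]))).
  apply: le_measure; rewrite ?inE//.
    by apply: measurableX; exact: measurable_itv.
  by move=> p /hM[h1 h2]; split; rewrite /= in_itv/= -ler_norml.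
by rewrite area_rect ?ltry//; lra.
Qed.

Lemma hdot_le_enorm th (p : pt R) : hdot th p <= enorm p.
Proof.
have [t [h1 h2]] := polar p.
have -> : hdot th p = enorm p * cos (th - t) by rewrite /hdot cosB h1 h2; ring.
by rewrite ler_piMr ?enorm_ge0// cos_le1.
Qed.

Lemma polar_turn (e : pt R) : exists th, [/\ 0 <= th <= 2 * pi,
  e.1 = enorm e * cos th & e.2 = enorm e * sin th].
Proof.
have pi0 := pi_gt0 R.
have half (f : pt R) : 0 <= f.1 -> exists th, [/\ - (pi / 2) <= th <= pi / 2,
    f.1 = enorm f * cos th & f.2 = enorm f * sin th] by exact: polar_half.
have [e1|e1] := leP 0 e.1.
  have [th [ht h1 h2]] := half e e1.
  have [t0|t0] := leP 0 th; first by exists th; split => //; lra.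
  exists (th + pi *+ 2); rewrite cosD2pi sinD2pi; split => //.
  by rewrite mulr2n; lra.
have [|th [ht h1 h2]] := half (- e.1, - e.2); first by rewrite /= oppr_ge0 ltW.
exists (th + pi); rewrite cosDpi sinDpi !mulrN; move: h1 h2; rewrite enormN/= => <- <-.
by rewrite !opprK; split => //; lra.
Qed.

(* A point outside X is separated from X by the normal at its nearest point. *)
Lemma inball_disk z r : compact X -> X !=set0 -> convex_set X -> 0 <= r ->
  inball X z r -> disk z r `<=` X.
Proof.
move=> kX X0 cX r0 hz p /(diskE _ _ r0) hp; apply: contrapT => Xp.
pose f (x : R * R) := (x.1 - p.1) ^+ 2 + (x.2 - p.2) ^+ 2.
have cf : continuous f.
  move=> x; apply: cvgD.
    apply: (cvg_comp _ (fun y : R => y ^+ 2)); last exact: exprn_continuous.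
    by apply: cvgB; [exact: cvg_fst|exact: cvg_cst].
  apply: (cvg_comp _ (fun y : R => y ^+ 2)); last exact: exprn_continuous.
  by apply: cvgB; [exact: cvg_snd|exact: cvg_cst].
have [q] := compact_EVT_min X0 kX (continuous_subspaceT cf).
rewrite inE => Xq hq.
pose e : pt R := (p.1 - q.1, p.2 - q.2).
have [th [hth e1 e2]] := polar_turn e.
have en : 0 < enorm e.
  rewrite lt_neqAle enorm_ge0 andbT; apply/eqP => /esym/enorm_eq0.
  rewrite /e => -[/eqP + /eqP]; rewrite !subr_eq0 => /eqP p1 /eqP p2.
  by apply: Xp; move: Xq; case: p q p1 p2 {hp f cf hq e e1 e2} => ? ? [? ?] /= -> ->.
have sep x : X x -> (x.1 - q.1) * e.1 + (x.2 - q.2) * e.2 <= 0.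
  move=> Xx; rewrite leNgt; apply/negP; set D := _ + _ => D0.
  pose S := (x.1 - q.1) ^+ 2 + (x.2 - q.2) ^+ 2.
  have S0 : 0 <= S by rewrite addr_ge0 ?sqr_ge0.
  (* Moving from [q] towards [x] by the ratio [t] changes the squared distance by
     [- 2 * t * D + t ^+ 2 * S]. This [t] is at most 1 and satisfies [t * S <= D], so the change is
     negative, against the minimality of [q]. *)
  pose t := D / (D + S).
  have DS : 0 < D + S by rewrite ltr_wpDr.
  have t0 : 0 < t by rewrite divr_gt0.
  have t1 : t <= 1 by rewrite ler_pdivrMr// mul1r lerDl.
  have tS : t * S <= D.
    have -> : t * S = D - t * D by rewrite /t; field; rewrite gt_eqF.
    by rewrite gerBl mulr_ge0// ltW.
  have t01 : 0 <= t <= 1 by rewrite ltW.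
  have := hq (t * x.1 + (1 - t) * q.1, t * x.2 + (1 - t) * q.2).
  rewrite inE => /(_ (convex_setP cX Xx Xq t01)).
  have -> : f (t * x.1 + (1 - t) * q.1, t * x.2 + (1 - t) * q.2) =
     f q - 2 * t * D + t * (t * S) by rewrite /f /D /S /e/=; ring.
  have : t * (t * S) <= t * D by rewrite ler_wpM2l// ltW.
  have : 0 < t * D by rewrite mulr_gt0.
  lra.
have hsup : supp X th <= hdot th q.
  have [x Xx [<- _]] := supp_attained kX X0 th.
  have := sep x Xx; rewrite e1 e2.
  have -> : (x.1 - q.1) * (enorm e * cos th) + (x.2 - q.2) * (enorm e * sin th) =
    enorm e * (hdot th x - hdot th q) by rewrite /hdot; ring.
  by rewrite pmulr_rle0// subr_le0.
have hpq : hdot th p = hdot th q + enorm e.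
  have -> : hdot th p = hdot th q + (e.1 * cos th + e.2 * sin th) by rewrite /hdot/e/=; ring.
  rewrite e1 e2 -[in RHS](mulr1 (enorm e)) -(cos2Dsin2 th); ring.
have := hz th hth.
have := hdot_le_enorm th (p.1 - z.1, p.2 - z.2).
have : enorm (p.1 - z.1, p.2 - z.2) <= r.
  by rewrite -ler_sqr ?nnegrE ?enorm_ge0// enorm2.
have -> : hdot th (p.1 - z.1, p.2 - z.2) = hdot th p - hdot th z by rewrite /hdot/=; ring.
lra.
Qed.

Lemma area_disk1 (z : pt R) : area (disk z 1) = area (@unit_disk R).
Proof.
have mD := @measurable_disk R (0, 0) 1 ler01.
rewrite -(area_shift (- z.1, - z.2) mD); congr area; apply/seteqP; split => p /=.
  by move=> /(diskE _ _ ler01); rewrite expr1n => h; apply/unit_diskE.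
by move=> /unit_diskE h; apply/diskE => //; rewrite expr1n.
Qed.

(** With a point outside the disk, [X] contains by convexity a small square disjoint from the disk,
    and its area then exceeds [pi]. *)
Lemma disk_area_eq z : compact X -> convex_set X -> disk z 1 `<=` X ->
  (area X <= pi%:E)%E -> X = disk z 1.
Proof.
move=> kX cX DX hA; apply/seteqP; split => // p Xp; apply: contrapT => Dp.
suff : (pi%:E < area X)%E by rewrite ltNge hA.
move: hA => _.
pose e : pt R := (p.1 - z.1, p.2 - z.2).
have [th [e1 e2]] := polar e; set d := enorm e in e1 e2.
have d1 : 1 < d.
  rewrite ltNge; apply/negP => hd; apply: Dp; apply/diskE => //.
  by rewrite -(enorm2 e) -/d expr1n expr_le1 ?enorm_ge0.
(* The centre [m] of the square is at distance [(d + 1) / 2] from [z], halfway between the circle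
   and [p]; [eta] is a quarter of [1 - la], so the square is the image of a square of half side
   [1 / 4] in the disk under contraction towards [p]. *)
pose la := (d + 1) / (2 * d); pose eta := (d - 1) / (8 * d).
have d0 : 0 < d by lra.
have la1 : 1 - la = 4 * eta by rewrite /la /eta; field; rewrite gt_eqF.
have lad : la * d = 1 + 4 * eta * d by rewrite /la /eta; field; rewrite gt_eqF.
have eta0 : 0 < eta by rewrite divr_gt0; lra.
have etad : eta < eta * d by rewrite ltr_pMr.
have la0 : 0 <= la by rewrite divr_ge0; lra.
pose m : pt R := (z.1 + la * e.1, z.2 + la * e.2).
pose S : set (pt R) := `[m.1 - eta, m.1 + eta] `*` `[m.2 - eta, m.2 + eta].
have SP v : S v -> `|v.1 - m.1| <= eta /\ `|v.2 - m.2| <= eta.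
  by move=> [/=]; rewrite !in_itv/= => h1 h2; rewrite !ler_norml; lra.
have SX : S `<=` X.
  move=> v /SP[v1 v2].
  have t01 : 0 <= la <= 1 by lra.
  pose w : pt R := (z.1 + (v.1 - m.1) / (4 * eta), z.2 + (v.2 - m.2) / (4 * eta)).
  have Xw : X w.
    apply: DX; apply/diskE => //.
    have e4 : 0 < 4 * eta by rewrite mulr_gt0.
    have -> : w.1 - z.1 = (v.1 - m.1) / (4 * eta) by rewrite /w [LHS]addrAC subrr add0r.
    have -> : w.2 - z.2 = (v.2 - m.2) / (4 * eta) by rewrite /w [LHS]addrAC subrr add0r.
    rewrite !expr_div_n expr1n -mulrDl ler_pdivrMr ?exprn_gt0// mul1r.
    have sq (y : R) : `|y| <= eta -> y ^+ 2 <= eta ^+ 2.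
      by move=> hy; rewrite -[y ^+ 2]real_normK ?num_real// ler_sqr ?nnegrE// ltW.
    have s1 := sq _ v1; have s2 := sq _ v2.
    have -> : (4 * eta) ^+ 2 = 16 * eta ^+ 2 by ring.
    by have := sqr_ge0 eta; lra.
  have := convex_setP cX Xp Xw t01; rewrite /= la1.
  have -> : 4 * eta * (z.1 + (v.1 - m.1) / (4 * eta)) = 4 * eta * z.1 + (v.1 - m.1).
    by field; rewrite gt_eqF.
  have -> : 4 * eta * (z.2 + (v.2 - m.2) / (4 * eta)) = 4 * eta * z.2 + (v.2 - m.2).
    by field; rewrite gt_eqF.
  rewrite -la1 /m /e/=; case: v {v1 v2 w Xw} => a b /=.
  by congr X; congr pair; ring.
have SD : S `&` disk z 1 = set0.
  apply/seteqP; split => // v [/SP[v1 v2] /(diskE _ _ ler01) hv].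
  have := hdot_le_enorm th (v.1 - z.1, v.2 - z.2).
  have : enorm (v.1 - z.1, v.2 - z.2) <= 1.
    by rewrite -ler_sqr ?nnegrE ?enorm_ge0// enorm2.
  have -> : hdot th (v.1 - z.1, v.2 - z.2) =
      hdot th (v.1 - m.1, v.2 - m.2) + la * (e.1 * cos th + e.2 * sin th).
    by rewrite /hdot /m/=; ring.
  have -> : e.1 * cos th + e.2 * sin th = d.
    by rewrite e1 e2 -[in RHS](mulr1 d) -(cos2Dsin2 th); ring.
  have := norm_hdot_le th (v.1 - m.1, v.2 - m.2).
  rewrite ler_norml/= => /andP[+ _]; rewrite lad; lra.
have mD : measurable (disk z 1 : set RR) by exact: measurable_disk.
have mS : measurable (S : set RR) by apply: measurableX; exact: measurable_itv.
have mX := compact_measurable2 kX.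
have : (area (S `|` disk z 1) <= area X)%E.
  apply: le_measure; rewrite ?inE//; first exact: measurableU.
  by move=> v [/SX|/DX].
have -> : area (S `|` disk z 1) = (area S + area (disk z 1))%E by exact: measureU.
have -> : area S = ((2 * eta) * (2 * eta))%:E.
  by rewrite area_rect; [congr EFin; ring|lra|lra].
rewrite area_disk1; apply: lt_le_trans.
apply: (@lt_le_trans _ _ ((2 * eta) * (2 * eta) + pi)%:E).
  by rewrite lte_fin ltrDr; apply: mulr_gt0; rewrite mulr_gt0.
by rewrite EFinD leeD2l// area_unit_disk_ge_pi.
Qed.

End EqualityCase.

Theorem theorem1 (R : realType) (X : set (pt R)) :
  compact X -> convex_set X -> interior X !=set0 ->
  has_perimeter X (2 * pi) -> ~ is_disk X ->
  exists eps : R, 0 < eps /\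
    forall l : R, 0 < l < eps -> buffon_prob X l < buffon_prob (@unit_disk R) l.
Proof.
move=> kX cX iX perX ndX; have pi0 := pi_gt0 R.
have [c [rho [rho0 hrho]]] := interior_square iX.
have Xc : X c by apply: hrho; rewrite subrr normr0 ltW.
have X0 : X !=set0 by exists c.
have mX := compact_measurable2 kX.
have hb ph : X (c.1 + rho * cos ph, c.2 + rho * sin ph).
  apply: hrho => /=; rewrite addrAC subrr add0r normrM gtr0_norm//.
    by rewrite ler_piMr ?cos_max// ltW.
  by rewrite ler_piMr ?sin_max// ltW.
have [M M0 hM] := bounded_coords kX.
have finX := area_compact_fin kX.
have [A AE] : exists A, area X = A%:E by exists (fine (area X)); rewrite fineK.
have A0 : 0 < A.
  have := square_area_le mX rho0 hrho; rewrite AE lee_fin; apply: lt_le_trans.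
  by rewrite !mulr_gt0.
have mD := @measurable_disk R (0, 0) 1 ler01.
have [AD ADE] : exists AD, area (@unit_disk R) = AD%:E.
  have DM : @unit_disk R `<=` `[- 1, 1] `*` `[- 1, 1].
    move=> p /unit_diskE hp.
    have p1 := sqr_ge0 p.1; have p2 := sqr_ge0 p.2.
    have sq (x : R) : x ^+ 2 <= 1 -> `[- 1, 1]%classic x.
      move=> hx; rewrite /= in_itv/= -ler_norml -ler_sqr ?nnegrE//.
      by rewrite real_normK ?num_real// expr1n.
    by split; apply: sq; lra.
  exists (fine (area (@unit_disk R))); rewrite fineK// ge0_fin_numE//.
  apply: (@le_lt_trans _ _ (area (`[(- 1)%R, 1%R] `*` `[(- 1)%R, 1%R]))).
    apply: le_measure; rewrite ?inE//.
    by apply: measurableX; exact: measurable_itv.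
  by rewrite area_rect ?ltry//; lra.
have ADpi : pi <= AD by rewrite -lee_fin -ADE; exact: area_unit_disk_ge_pi.
(* [2 * C * a] is the sector error [2 * pi * (4 * M * a)] of [needle_set_upper]. *)
pose C := 4 * pi * M.
have C0 : 0 <= C by rewrite !mulr_ge0// ltW.
(* Either some number of directions already shows a strict excess beyond the sector error, or none
   does and [X] is a disk. *)
have [[K [K1 hK]]|noK] := pselect (exists K, (1 < K)%N /\
    4 * A + 2 * C * step R (4 * K) < 2 * step R (4 * K) *
      \sum_(0 <= k < 4 * K) supp X (k%:R * step R (4 * K))); last first.
  have [|Api [z zX]] := extremal_inball kX X0 AE A0 C0 (ltW M0) hM perX.
    move=> K K1; rewrite leNgt; apply/negP => hK; apply: noK; by exists K.
  exfalso; apply: ndX; exists z, 1; split => //.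
  apply: disk_area_eq => //; last by rewrite AE lee_fin.
  exact: (inball_disk kX X0 cX ler01 zX).
set a := step R (4 * K) in hK; set S := \sum_(_ <= _ < _) _ in hK.
pose g := 2 * a * S - 4 * A - 2 * C * a.
have g0 : 0 < g by rewrite /g; lra.
pose ka := 2 * M / rho.
have ka0 : 0 < ka by rewrite divr_gt0// mulr_gt0.
have pk : 0 < 4 * pi * ka by rewrite mulr_gt0// mulr_gt0.
(* The second bound lets the margin [g] absorb the quadratic error [4 * pi * ka * l]; the first
   gives [2 * l <= 2 <= pi], hence at most the area of the disk. *)
exists (Num.min 1 (g / (4 * pi * ka))); split; first by rewrite lt_min ltr01 divr_gt0.
move=> l; rewrite lt_min => /and3P[l0 l1]; rewrite ltr_pdivlMr// => lg.
have [V VE ->] := buffon_probE l mX cX AE.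
have [W WE ->] := buffon_probE l mD (@convex_unit_disk R) ADE.
have := needle_set_upper kX cX AE M0 hM rho0 hb Xc l0 K1.
rewrite VE lee_fin -/a -/S -/ka => hV.
have pi2 := pi_ge2 R.
have lD : 2 * l <= AD by lra.
have := needle_set_ge mD ADE lD (fun th => exit_area_unit_disk th l0).
rewrite WE lee_fin => hW.
have pA : 0 < 2 * pi * A by rewrite !mulr_gt0.
have pAD : 0 < 2 * pi * AD by rewrite !mulr_gt0//; lra.
have split_prob (p x y : R) : p != 0 ->
    (1 - 2 * x / p) * (2 * p * y) = 2 * p * y - x * (4 * y).
  by move=> p0; field.
(* The separating value is the first-order expansion for the disk. The remaining comparison with the
   disk needs only that its area is at least [pi]. *)
apply: (@lt_le_trans _ _ (1 - 2 * l / pi)).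
  rewrite ltr_pdivrMr//.
  rewrite split_prob ?gt_eqF//.
  apply: (le_lt_trans hV); rewrite ltrD2l ltrN2 ltr_pM2l//.
  by move: lg; rewrite /g /C; lra.
rewrite ler_pdivlMr//.
rewrite split_prob ?gt_eqF//.
have : l * pi <= l * AD by rewrite ler_wpM2l// ltW.
by move: hW; lra.
Qed.
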